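(* Let $R$ be a countable ring. There exists an uncountable Polish left $R$-module with a Kaplansky decomposition if and only if there exists a nonzero indecomposable endofinite left $R$-module. Equivalently, if and only if there exists an indecomposable endofinite right $R$-module.
   Context: Rings have an identity $1\neq 0$; modules are unital; $R$ is given the discrete topology. A Polish $R$-module is an $R$-module $A$ with a separable completely metrizable topology for which $(A,+,-,0)$ is a topological group and scalar multiplication $R\times A\to A$ is continuous. A Kaplansky decomposition of $A$ is an algebraic direct sum decomposition $A=\bigoplus_{i\in I}A_i$ with every $A_i$ nonzero and countable. A module $V$ is endofinite if it has finite length as a module over its endomorphism ring $\mathrm{End}_R V$. Indecomposable modules are nonzero. *)

(* Defs.v *)
From HB Require Import structures.
From mathcomp Require Import all_boot all_order all_algebra.
From mathcomp Require Import all_classical all_reals.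
From mathcomp Require Import topology normedtype_theory.tvs.

Set Implicit Arguments.
Unset Strict Implicit.
Unset Printing Implicit Defensive.

Import Order.TTheory GRing.Theory Num.Theory.

Local Open Scope classical_set_scope.
Local Open Scope ring_scope.

Section Modules.
Context (S : pzRingType) (M : lmodType S).

Definition submodule (U : set M) : Prop := submod_closed [in U].

(* [M] is the internal direct sum of the [U i]: every element is, in exactly
   one way, a finite sum of elements [f i] of the [U i]. *)
Definition direct_sum (I : choiceType) (U : I -> set M) : Prop :=
  forall x : M, exists! f : I -> M,
    [/\ forall i, U i (f i), finite_set [set i | f i != 0]
      & x = \sum_(i \in [set: I]) f i].

Definition kaplansky_decomposition (I : choiceType) (U : I -> set M) : Prop :=
  (forall i, [/\ submodule (U i), U i != [set 0] & countable (U i)]) /\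
  direct_sum U.

Definition indecomposable : Prop :=
  (exists x : M, x != 0) /\
  forall U W : set M, submodule U -> submodule W ->
    U `&` W = [set 0] -> (forall x, exists u w, [/\ U u, W w & x = u + w]) ->
    U = [set 0] \/ W = [set 0].

(* [U] is a maximal proper submodule of [W], i.e. the quotient is simple. *)
Definition maximal_in (U W : set M) : Prop :=
  U `<` W /\
  forall X : set M, submodule X -> U `<=` X -> X `<=` W -> X = U \/ X = W.

Definition composition_series (n : nat) (U : nat -> set M) : Prop :=
  [/\ U 0%N = [set 0], U n = [set: M],
      forall i, (i <= n)%N -> submodule (U i)
    & forall i, (i < n)%N -> maximal_in (U i) (U i.+1)].

Definition finite_length : Prop := exists n U, composition_series n U.

End Modules.

Definition endo (S : pzRingType) (V : lmodType S) : Type := {linear V -> V}.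

Section EndomorphismRing.
Context (S : pzRingType) (V : lmodType S).

Definition endo_fun (f : endo V) : {linear V -> V} := f.

HB.instance Definition _ := gen_eqMixin (endo V).
HB.instance Definition _ := gen_choiceMixin (endo V).

Lemma endo_ext (f g : endo V) : endo_fun f =1 endo_fun g -> f = g.
Proof.
move: f g => [f cf] [g cg] /funext /= fg; subst g.
case: cf cg => [[a1] [a2]] [[b1] [b2]].
by rewrite (Prop_irrelevance a1 b1) (Prop_irrelevance a2 b2).
Qed.

Let zero : endo V := (\0 : V -> V).
Let opp (f : endo V) : endo V := (\- endo_fun f).
Let add (f g : endo V) : endo V := (endo_fun f \+ endo_fun g).
Let one : endo V := (idfun : V -> V).
Let mul (f g : endo V) : endo V := (endo_fun f \o endo_fun g).

Let addA : associative add.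
Proof. by move=> f g h; apply: endo_ext => x; exact: addrA. Qed.
Let addC : commutative add.
Proof. by move=> f g; apply: endo_ext => x; exact: addrC. Qed.
Let add0 : left_id zero add.
Proof. by move=> f; apply: endo_ext => x; exact: add0r. Qed.
Let addN : left_inverse zero opp add.
Proof. by move=> f; apply: endo_ext => x; exact: addNr. Qed.
Let mulA : associative mul.
Proof. by move=> f g h; apply: endo_ext. Qed.
Let mul1 : left_id one mul.
Proof. by move=> f; apply: endo_ext. Qed.
Let mul_1 : right_id one mul.
Proof. by move=> f; apply: endo_ext. Qed.
Let mulDl : left_distributive mul add.
Proof. by move=> f g h; apply: endo_ext. Qed.
Let mulDr : right_distributive mul add.
Proof. by move=> f g h; apply: endo_ext => x; exact: linearD. Qed.

HB.instance Definition _ := GRing.isPzRing.Build (endo V)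
  addA addC add0 addN mulA mul1 mul_1 mulDl mulDr.

Lemma endo_addE (f g : endo V) x :
  endo_fun (f + g) x = endo_fun f x + endo_fun g x.
Proof. by []. Qed.

Lemma endo_mulE (f g : endo V) x :
  endo_fun (f * g) x = endo_fun f (endo_fun g x).
Proof. by []. Qed.

Lemma endo_oneE x : endo_fun 1 x = x.
Proof. by []. Qed.

End EndomorphismRing.

(* The group [V], regarded as a module over its endomorphism ring. *)
Definition endo_module (S : pzRingType) (V : lmodType S) : Type := V.

Section EndomorphismModule.
Context (S : pzRingType) (V : lmodType S).

HB.instance Definition _ := GRing.Zmodule.copy (endo_module V) V.

Let scale (f : endo V) (v : endo_module V) : endo_module V := endo_fun f v.

Let scaleA f g v : scale f (scale g v) = scale (f * g) v.
Proof. by []. Qed.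
Let scale1 : left_id 1 scale.
Proof. by []. Qed.
Let scaleDr : right_distributive scale +%R.
Proof. by move=> f u v; exact: linearD. Qed.
Let scaleDl v : {morph scale^~ v : f g / f + g}.
Proof. by []. Qed.

HB.instance Definition _ := GRing.Zmodule_isLmodule.Build
  (endo V) (endo_module V) scaleA scale1 scaleDr scaleDl.

Lemma endo_scaleE (f : endo V) (v : V) :
  f *: (v : endo_module V) = endo_fun f v.
Proof. by []. Qed.

End EndomorphismModule.

Definition endofinite (S : pzRingType) (V : lmodType S) : Prop :=
  finite_length (endo_module V).

(* The library's topological modules are restricted to scalars in a
   [numDomainType]; here the scalars are an arbitrary ring, taken with the
   discrete topology. *)
Record topModule (R : pzRingType) := TopModule {
  topModule_zmod : topologicalZmodType ;
  topModule_scale : R -> topModule_zmod -> topModule_zmod ;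
  topModule_scaleA : forall a b v,
    topModule_scale a (topModule_scale b v) = topModule_scale (a * b) v ;
  topModule_scale1 : left_id 1 topModule_scale ;
  topModule_scaleDr : right_distributive topModule_scale +%R ;
  topModule_scaleDl : forall v,
    {morph topModule_scale^~ v : a b / a + b} ;
  topModule_scale_continuous : continuous
    (fun z : discrete_topology R * topModule_zmod => topModule_scale z.1 z.2)
}.

Definition topModule_sort (R : pzRingType) (A : topModule R) : Type :=
  topModule_zmod A.

Coercion topModule_sort : topModule >-> Sortclass.

Section TopModule.
Context (R : pzRingType) (A : topModule R).

HB.instance Definition _ := TopologicalZmodule.copy A (topModule_zmod A).

HB.instance Definition _ := GRing.Zmodule_isLmodule.Build R A
  (@topModule_scaleA R A) (@topModule_scale1 R A)
  (@topModule_scaleDr R A) (@topModule_scaleDl R A).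

End TopModule.

Section Polish.
Context (K : realType).

Definition is_metric (T : Type) (d : T -> T -> K) : Prop :=
  [/\ forall x y, 0 <= d x y,
      forall x y, d x y = 0 <-> x = y,
      forall x y, d x y = d y x
    & forall x y z, d x z <= d x y + d y z].

Definition metric_compatible (T : topologicalType) (d : T -> T -> K) : Prop :=
  forall (x : T) (U : set T),
    nbhs x U <-> exists2 e : K, 0 < e & [set y | d x y < e] `<=` U.

Definition metric_complete (T : topologicalType) (d : T -> T -> K) : Prop :=
  forall u : nat -> T,
    (forall e : K, 0 < e ->
       exists N, forall m n, (N <= m)%N -> (N <= n)%N -> d (u m) (u n) < e) ->
    exists l : T, u @ \oo --> l.

Definition completely_metrizable (T : topologicalType) : Prop :=
  exists d : T -> T -> K,
    [/\ is_metric d, metric_compatible d & metric_complete d].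

Definition separable (T : topologicalType) : Prop :=
  exists2 D : set T, countable D & dense D.

Definition polish (T : topologicalType) : Prop :=
  separable T /\ completely_metrizable T.

End Polish.

(* Main.v *)
Require Import Defs.
From HB Require Import structures.
From mathcomp Require Import all_boot all_order all_algebra.
From mathcomp Require Import all_classical all_reals.
From mathcomp Require Import topology normedtype_theory.tvs.
From mathcomp Require Import generic_quotient lra.

Set Implicit Arguments.
Unset Strict Implicit.
Unset Printing Implicit Defensive.

Import Order.TTheory GRing.Theory Num.Theory.

Local Open Scope classical_set_scope.
Local Open Scope ring_scope.

(** Everything passes through an intermediate condition on [R], [represented]:
    there is a unital ring homomorphism [R -> M_n(D)] with [D] a division ring
    and [0 < n].  Transposition, with [D^c] in place of [D], carries it to the
    opposite ring, so it is symmetric between left and right modules.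

    From endofinite modules to matrices ([endofinite_structure]).  Let [V] be a
    nonzero module whose length [n] over [E = End_R V] is the least possible
    among all nonzero [R]-modules.  A nonzero subgroup that is both an
    [R]-submodule and an [E]-submodule has endolength at most its [E]-length,
    so it is all of [V].  For a simple [E]-submodule [S], the sum of the images
    [r S] is such a subgroup; hence [V] is a finite direct sum of copies
    [r_j S] of [S], and [R] acts on it by matrices over [D = End_E S].  Thus
    [V = S^m], and [D^m] is an [R]-module of length at most [m] over its
    endomorphisms.  It is indecomposable: a projection of [D^m], spread over
    [S^m] by means of a [D]-linear functional on [S], becomes an element of [E],
    acts by the same map on each coordinate, and is therefore right
    multiplication by an idempotent of [D].

    From matrices to Polish modules ([represented_polish]).  Entries and field
    operations of a countable ring generate a countable [D].  The module
    [(D^n)^nat] of sequences, with the product topology, is Polish and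
    uncountable; as an [R]-module it is [N^n] for the [D]-space [N = D^nat], and
    a basis of [N] decomposes it into countable pieces.

    From Polish modules to endofinite modules ([polish_kaplansky_endofinite]).
    Let [A] be Polish, uncountable and the direct sum of countable [A_i].
    Consider the additive relations on [A] that are projections of closed
    subgroups of powers [A^T], [T] countable, invariant under the coordinate
    projections ([witnessed]); they play the role of the positive primitive
    formulas and are stable under composition, inverse, intersection and sum.
    Compare them up to countably many summands: [phi] is essentially contained
    in [psi] if it is contained in [psi] on all but countably many [A_i].
    Completeness forces the descending chain condition for this order
    ([descent]): along a bad chain one can add up
    differences [y_i - y_j] of elements of the summands, so small, together
    with their witnesses, that the sum converges to an element of infinite
    support.

    Essential inclusion is an instance of a [serre] order, the analogue of a
    Serre subcategory of the category of definable subquotients.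
    Zorn gives a maximal one that does not collapse [A].  By the chain
    condition there is a simple definable subgroup [phi] for it, and by
    maximality [A] is obtained in finitely many steps from quotients of
    subgroups of [phi] ([maximal_layers]).  The definable morphisms from [phi]
    to [A] in the localized category ([arrow_module]) form an [R]-module [V],
    on which the endomorphisms of [phi] act by precomposition; each step
    contributes at most one to its length over them ([layer_dimension]), so
    [V] is nonzero and endofinite. *)

(** * Submodules and finite length *)

Section Submodules.
Context (S : pzRingType) (M : lmodType S).
Implicit Types U W X Y : set M.

Lemma submoduleP U : submodule U <->
  [/\ U 0, forall x y, U x -> U y -> U (x + y) & forall a x, U x -> U (a *: x)].
Proof.
split.
- move=> [U0 UZ]; have {}U0 : U 0 by move: U0; rewrite inE.
  have {}UZ a x y : U x -> U y -> U (a *: x + y).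
    move=> Ux Uy; suff : a *: x + y \in [in U] by rewrite inE.
    by apply: UZ; rewrite inE.
  split=> // [x y Ux Uy|a x Ux]; first by rewrite -[x]scale1r; apply: UZ.
  by rewrite -[a *: x]addr0; apply: UZ.
- move=> [U0 UD UZ]; split; first by rewrite inE.
  move=> a x y; rewrite !inE => Ux Uy.
  by apply: UD => //; apply: UZ.
Qed.

Lemma submodule0 U : submodule U -> U 0. Proof. by case/submoduleP. Qed.
Lemma submoduleD U x y : submodule U -> U x -> U y -> U (x + y).
Proof. by case/submoduleP => _ + _; exact. Qed.
Lemma submoduleZ U a x : submodule U -> U x -> U (a *: x).
Proof. by case/submoduleP => _ _; exact. Qed.
Lemma submoduleN U x : submodule U -> U x -> U (- x).
Proof. by move=> sU Ux; rewrite -scaleN1r; apply: submoduleZ. Qed.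
Lemma submoduleB U x y : submodule U -> U x -> U y -> U (x - y).
Proof. by move=> sU Ux Uy; apply: submoduleD => //; apply: submoduleN. Qed.

Lemma submodule_sum U (J : Type) (r : seq J) (P : pred J) (F : J -> M) :
  submodule U -> (forall j, P j -> U (F j)) -> U (\sum_(j <- r | P j) F j).
Proof.
move=> sU UF; elim/big_rec: _ => [|j x Pj Ux]; first exact: submodule0.
by apply: submoduleD => //; apply: UF.
Qed.

Lemma submodule_set0 : submodule [set 0 : M].
Proof.
apply/submoduleP; split=> //= [x y -> ->|a x ->]; first by rewrite addr0.
by rewrite scaler0.
Qed.

Lemma submodule_setT : submodule [set: M].
Proof. exact/submoduleP. Qed.

Lemma submodule_setI U W : submodule U -> submodule W -> submodule (U `&` W).
Proof.
move=> sU sW; apply/submoduleP; split.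
- by split; apply: submodule0.
- by move=> x y [? ?] [? ?]; split; apply: submoduleD.
- by move=> a x [? ?]; split; apply: submoduleZ.
Qed.

Lemma submodule_add U W : submodule U -> submodule W ->
  submodule [set x | exists u w, [/\ U u, W w & x = u + w]].
Proof.
move=> sU sW; apply/submoduleP; split.
- by exists 0, 0; split; rewrite ?addr0 //; apply: submodule0.
- move=> _ _ [u [w [Uu Ww ->]]] [u' [w' [Uu' Ww' ->]]].
  by exists (u + u'), (w + w'); split; rewrite 1?addrACA //; apply: submoduleD.
- move=> a _ [u [w [Uu Ww ->]]].
  by exists (a *: u), (a *: w); split; rewrite ?scalerDr //; apply: submoduleZ.
Qed.

(** A strictly monotone height on submodules is easier to transport between
    modules than a composition series; [composition_series_length] and
    [length_finite] show that its existence amounts to finite length. *)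
Definition length_at_most (n : nat) : Prop :=
  exists mu : set M -> nat,
    (forall X, submodule X -> (mu X <= n)%N) /\
    (forall X Y, submodule X -> submodule Y -> X `<` Y -> (mu X < mu Y)%N).

(** The height of [X] is the number of steps of the filtration at which [X] gains
    an element; two nested submodules that gain at the same steps are equal, by
    induction along the filtration.  The [U k] are mere sets, so that the lemma
    also applies to filtrations that the scalars do not preserve. *)
Lemma filtration_length (n : nat) (U : nat -> set M) :
  U 0%N `<=` [set 0] -> U n = [set: M] ->
  (forall X k, submodule X -> (k < n)%N ->
     forall w, X w -> U k.+1 w -> ~ U k w ->
     forall v, U k.+1 v -> exists2 x, X x & U k (v - x)) ->
  length_at_most n.
Proof.
move=> U0 Un Ustep.
pose gain X := [set k : 'I_n | `[< exists w, [/\ X w, U k.+1 w & ~ U k w] >]]%SET.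
exists (fun X => #|gain X|); split=> [X _|X Y sX sY [XY YX]].
  by rewrite -[leqRHS]card_ord max_card.
apply/proper_card; rewrite finset.properEneq; apply/andP; split; last first.
  apply/fintype.subsetP => k; rewrite !finset.in_set => /asboolP[w [Xw Uw nUw]].
  by apply/asboolP; exists w; split=> //; apply: XY.
apply/eqP => eqg; apply: YX => y.
suff {y} H k y : (k <= n)%N -> Y y -> U k y -> X y.
  by move=> Yy; apply: (H n) => //; rewrite Un.
elim: k y => [|k IH] y kn Yy Uy; first by rewrite (U0 _ Uy); apply: submodule0.
have [Uky|nUky] := pselect (U k y); first by apply: IH => //; apply: ltnW.
have : Ordinal kn \in gain X.
  by rewrite eqg finset.in_set; apply/asboolP; exists y.
rewrite finset.in_set => /asboolP[/= w [Xw Uw nUw]].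
have [x Xx Uyx] := Ustep X k sX kn w Xw Uw nUw y Uy.
rewrite -[y](subrK x); apply: submoduleD => //.
by apply: IH => //; [apply: ltnW|apply: submoduleB => //; apply: XY].
Qed.

Lemma composition_series_length n (U : nat -> set M) :
  composition_series n U -> length_at_most n.
Proof.
move=> [U0 Un sU maxU]; apply: (@filtration_length n U) => //; first by rewrite U0.
move=> X k sX kn w Xw Uw nUw v Uv.
have [[Uk _] mx] := maxU k kn.
have sUk := sU k (ltnW kn); have sUk1 := sU k.+1 kn.
pose Y := [set x | exists u w, [/\ U k u, (X `&` U k.+1) w & x = u + w]].
have [|||YU|YU] := mx Y.
- by apply: submodule_add => //; apply: submodule_setI.
- move=> u Uu; exists u, 0; split; rewrite ?addr0 //.
  by split; apply: submodule0.
- by move=> _ [u [x [Uu [Xx Ux] ->]]]; apply: submoduleD => //; apply: Uk.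
- case: nUw; rewrite -YU; exists 0, w; split; rewrite ?add0r //.
  exact: submodule0.
- have : Y v by rewrite YU.
  by case=> u [x [Uu [Xx _] ->]]; exists x; rewrite ?addrK.
Qed.

(** Going down from [X], a proper submodule of largest height is maximal; the
    height bounds the number of steps. *)
Lemma length_finite n : length_at_most n -> finite_length M.
Proof.
move=> [mu [mun mulT]].
suff H m X : submodule X -> (mu X <= m)%N -> exists k (U : nat -> set M),
    [/\ U 0%N = [set 0], U k = X, forall i, (i <= k)%N -> submodule (U i)
      & forall i, (i < k)%N -> maximal_in (U i) (U i.+1)].
  have [k [U ?]] := H n [set: M] submodule_setT (mun _ submodule_setT).
  by exists k, U.
elim: m X => [|m IH] X sX Xm; have [X0|nX0] := pselect (X = [set 0]);
  try by exists 0%N, (fun=> X); split=> // i; rewrite ltn0.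
all: have X0X : [set 0] `<` X by
  split=> [_ ->|X0]; [exact: submodule0|apply: nX0; apply/seteqP; split=> // _ ->;
  exact: submodule0].
  have := mulT _ _ submodule_set0 sX X0X.
  by rewrite ltnNge (leq_trans Xm).
pose P k := `[< exists Y, [/\ submodule Y, Y `<` X & mu Y = k] >].
have exP : exists k, P k.
  by exists (mu [set 0]); apply/asboolP; exists [set 0]; split=> //;
    exact: submodule_set0.
have Pn k : P k -> (k <= n)%N by move=> /asboolP[Y [sY _ <-]]; apply: mun.
case: (ex_maxnP exP Pn) => _ /asboolP[Y [sY YX <-]] maxY.
have maxYX : maximal_in Y X.
  split=> // Z sZ YZ ZX; have [->|nZX] := pselect (Z = X); first by right.
  left; apply/seteqP; split=> //; apply: contrapT => nZY.
  have : (mu Y < mu Z)%N by apply: mulT.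
  rewrite ltnNge maxY //; apply/asboolP; exists Z; split=> //; split=> // XZ.
  by apply: nZX; apply/seteqP.
have [|k [U [U0 Uk sU maxU]]] := IH Y sY.
  by rewrite -ltnS (leq_trans _ Xm) // mulT.
exists k.+1, (fun i => if i == k.+1 then X else U i); split=> //=.
- by rewrite eqxx.
- by move=> i; rewrite leq_eqVlt; case: eqP => //= _; rewrite ltnS; apply: sU.
- move=> i; rewrite ltnS leq_eqVlt => /predU1P[->|ik].
    by rewrite eqxx ltn_eqF // Uk.
  rewrite (ltn_eqF (_ : i < k.+1)%N) ?ltnS 1?ltnW // eqSS (ltn_eqF ik).
  exact: maxU.
Qed.

End Submodules.

(** * Submodules as modules *)

(** The proof of closure is a parameter of the type because the module structure
    is built from it. *)
Definition submod_type (S : pzRingType) (M : lmodType S) (U : set M)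
  (sU : submodule U) : Type := {x : M | x \in [in U]}.

Section SubmodType.
Context (S : pzRingType) (M : lmodType S) (U : set M) (sU : submodule U).

HB.instance Definition _ := SubChoice.copy (submod_type sU) {x : M | x \in [in U]}.
HB.instance Definition _ :=
  GRing.SubChoice_isSubLmodule.Build S M _ (submod_type sU) (GRing.submod_closed_semi sU).

Lemma submod_typeP (x : submod_type sU) : U (val x).
Proof. by have := valP x; rewrite inE. Qed.

Lemma submod_type_ex (x : M) : U x -> exists u : submod_type sU, val u = x.
Proof.
move=> Ux; have Ux' : x \in [in U] by rewrite inE.
by exists (exist _ x Ux').
Qed.

End SubmodType.

Lemma endo_ex (S : pzRingType) (V : lmodType S) (f : V -> V) :
  linear f -> exists e : endo V, endo_fun e =1 f.
Proof.
move=> lf.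
pose g : {linear V -> V} := HB.pack f (GRing.isLinear.Build S V V *:%R f lf).
by exists g.
Qed.

(** * Matrix representations over division rings *)

(** Left inverses of all nonzero elements suffice: see [division_ringV]. *)
Definition division_ring (D : pzRingType) : Prop :=
  1 != 0 :> D /\ forall x : D, x != 0 -> exists y, y * x = 1.

Lemma division_ringV (D : pzRingType) : division_ring D ->
  forall x : D, x != 0 -> exists y, y * x = 1 /\ x * y = 1.
Proof.
move=> [D1 DV] x x0; have [y yx] := DV x x0; exists y; split=> //.
have y0 : y != 0.
  by apply: contraNneq D1 => y0; rewrite -yx y0 mul0r.
have [z zy] := DV y y0.
by have -> : x = z by rewrite -[x]mul1r -zy -mulrA yx mulr1.
Qed.

Record matrix_rep (R D : pzRingType) (n : nat) := MatrixRep {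
  rep_fun :> R -> 'M[D]_n ;
  rep_add : forall a b, rep_fun (a + b) = rep_fun a + rep_fun b ;
  rep_mul : forall a b, rep_fun (a * b) = rep_fun a *m rep_fun b ;
  rep_one : rep_fun 1 = 1%:M }.

Definition represented (R : pzRingType) (n : nat) : Prop :=
  exists D : pzRingType, division_ring D /\ inhabited (matrix_rep R D n).

(** Transposition reverses products, and so does passing to the opposite ring. *)
Lemma represented_conv (R : pzRingType) n : represented R n -> represented R^c n.
Proof.
move=> [D [[D1 DV] [rho]]]; exists D^c; split.
  split=> // x x0; have [y [_ xy]] := division_ringV (conj D1 DV) x0.
  by exists y.
constructor; apply: (@MatrixRep R^c D^c n (fun a => (rho a)^T)) => [a b|a b|].
- by rewrite rep_add; apply/matrixP => i j; rewrite !mxE.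
- apply/matrixP => i j; rewrite !mxE -[a * b]/((b : R) * (a : R)) rep_mul mxE.
  by apply: eq_bigr => k _; rewrite !mxE.
- by apply/matrixP => i j; rewrite rep_one !mxE eq_sym.
Qed.

Lemma represented_conv2 (R : pzRingType) n : represented R^c n -> represented R n.
Proof.
move=> /represented_conv[D [dD [rho]]]; exists D; split=> //; constructor.
apply: (@MatrixRep R D n (fun a => rho a)) => [a b|a b|].
- exact: rep_add.
- exact: rep_mul.
- exact: rep_one.
Qed.

(** The representation is kept in the type since the action of [R] on the power
    [N^n] depends on it. *)
Definition column_module (R D : pzRingType) (n : nat) (rho : matrix_rep R D n)
  (N : lmodType D) : Type := 'I_n -> N.

Section ColumnModule.
Context (R D : pzRingType) (n : nat) (rho : matrix_rep R D n) (N : lmodType D).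

HB.instance Definition _ := GRing.Zmodule.copy (column_module rho N) ('I_n -> N).

Let scale (a : R) (x : column_module rho N) : column_module rho N :=
  fun i => \sum_j rho a i j *: x j.

Let scaleA a b x : scale a (scale b x) = scale (a * b) x.
Proof.
apply/funext => i; rewrite /scale rep_mul.
under eq_bigr do rewrite scaler_sumr.
rewrite exchange_big /=; apply: eq_bigr => j _.
rewrite mxE scaler_suml; apply: eq_bigr => k _; exact: scalerA.
Qed.
Let scale1 : left_id 1 scale.
Proof.
move=> x; apply/funext => i; rewrite /scale rep_one (bigD1 i) //= big1.
  by rewrite mxE eqxx scale1r addr0.
by move=> j ji; rewrite mxE eq_sym (negbTE ji) scale0r.
Qed.
Let scaleDr : right_distributive scale +%R.
Proof.
move=> a x y; apply/funext => i.
rewrite -[RHS]/(scale a x i + scale a y i) /scale -big_split /=.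
by apply: eq_bigr => j _; rewrite -scalerDr.
Qed.
Let scaleDl v : {morph scale^~ v : a b / a + b}.
Proof.
move=> a b; apply/funext => i.
rewrite -[RHS]/(scale a v i + scale b v i) /scale -big_split /=.
by apply: eq_bigr => j _; rewrite rep_add mxE scalerDl.
Qed.

HB.instance Definition _ := GRing.Zmodule_isLmodule.Build
  R (column_module rho N) scaleA scale1 scaleDr scaleDl.

Lemma column_scaleE a (x : column_module rho N) i :
  (a *: x) i = \sum_j rho a i j *: x j.
Proof. by []. Qed.

Lemma column_addE (x y : column_module rho N) i : (x + y) i = x i + y i.
Proof. by []. Qed.

End ColumnModule.

Section ColumnMap.
Context (R D : pzRingType) (n : nat) (rho : matrix_rep R D n).
Context (N P : lmodType D) (f : N -> P).

Definition column_map (x : column_module rho N) : column_module rho P :=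
  fun i => f (x i).

(** [N |-> N^n] is a functor from [D]-modules to [R]-modules. *)
Lemma column_map_linear : linear f -> linear column_map.
Proof.
move=> lf a x y; apply/funext => i.
pose g : {linear N -> P} := HB.pack f (GRing.isLinear.Build D N P *:%R f lf).
rewrite /column_map -[f]/(g : N -> P) column_addE column_scaleE linearD linear_sum.
by congr (_ + _); rewrite column_scaleE; apply: eq_bigr => j _; exact: linearZ.
Qed.

End ColumnMap.

Definition endolength_at_most (R : pzRingType) (V : lmodType R) (n : nat) :=
  length_at_most (endo_module V) n.

(** Right multiplications by elements of [D] are [R]-linear, so that the subspaces
    where all but the first [k] coordinates vanish form a filtration with steps
    of dimension one. *)
Lemma column_endolength (R D : pzRingType) n (rho : matrix_rep R D n) :
  division_ring D -> endolength_at_most (column_module rho D^o) n.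
Proof.
move=> dD; apply: (@filtration_length _ (endo_module (column_module rho D^o)) n
   (fun k => [set x | forall j : 'I_n, (k <= j)%N -> x j = 0])).
- by move=> x x0; apply/funext => j; rewrite x0.
- by apply/seteqP; split=> // x _ j; rewrite leqNgt ltn_ord.
move=> X k sX kn w Xw Uw nUw v Uv.
have wk0 : w (Ordinal kn) != 0.
  apply/eqP => wk0; apply: nUw => j; rewrite leq_eqVlt => /predU1P[kj|]; last exact: Uw.
  by rewrite -wk0; congr w; apply: val_inj; rewrite /= kj.
have [y [_ wy]] := division_ringV dD wk0.
have [|f fE] := @endo_ex R (column_module rho D^o)
    (@column_map R D n rho D^o D^o (fun d : D => d * (y * v (Ordinal kn)))).
  by apply: column_map_linear => a c d; rewrite mulrDl /= -[_ *: c]/(a * c) -mulrA.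
exists (f *: w); first exact: submoduleZ.
move=> j kj; rewrite -[X in X = _]/(v j - (endo_fun f w) j) fE /column_map.
move: kj; rewrite leq_eqVlt => /predU1P[kj|kj].
  have -> : j = Ordinal kn by apply: val_inj; rewrite /= kj.
  by rewrite mulrA wy mul1r subrr.
by rewrite Uv // Uw // mul0r subrr.
Qed.

Lemma column_nonzero (R D : pzRingType) n (rho : matrix_rep R D n) :
  division_ring D -> (0 < n)%N -> exists x : column_module rho D^o, x != 0.
Proof.
move=> [D1 _] n0; exists (fun=> 1); apply/eqP => /(congr1 (fun x => x (Ordinal n0))).
by apply/eqP.
Qed.

(** * Direct sums and bases *)

Section DirectSums.
Context (S : pzRingType) (M : lmodType S).

(** Sums over a finite support are computed along any list that covers it; this
    lets several supports be handled at once. *)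
Lemma fsum_seq (I : choiceType) (N : nmodType) (s : seq I) (f : I -> N) :
  uniq s -> (forall i, f i != 0 -> i \in s) ->
  \sum_(i \in [set: I]) f i = \sum_(i <- s) f i.
Proof.
move=> us fs; rewrite (@fsbigE _ _ _ _ _ s) //; last first.
  by move=> i _; apply: contraNeq => /fs.
by apply: eq_bigl => i; rewrite in_setT.
Qed.

Lemma finite_support_seq (I : choiceType) (N : nmodType) (f : I -> N) :
  finite_set [set i | f i != 0] ->
  exists s : seq I, uniq s /\ forall i, f i != 0 -> i \in s.
Proof.
move=> /finite_seqP[s sE]; exists (undup s); split=> [|i fi].
  exact: undup_uniq.
by rewrite mem_undup; have : [set i | f i != 0] i by []; rewrite sE.
Qed.

Lemma seq_finite_support (I : choiceType) (N : nmodType) (s : seq I) (f : I -> N) :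
  (forall i, f i != 0 -> i \in s) -> finite_set [set i | f i != 0].
Proof.
by move=> fs; apply: (@sub_finite_set _ _ [set` s]) => [i /fs|]; last exact: finite_seq.
Qed.

(** Linear projections carry the same information as [direct_sum], and transport
    along functors. *)
Definition projections (I : choiceType) (U : I -> set M) (p : I -> M -> M) :=
  [/\ forall i, linear (p i), forall i x, U i (p i x),
      forall x, finite_set [set i | p i x != 0],
      forall x, x = \sum_(i \in [set: I]) p i x
    & forall i j x, U i x -> p j x = if j == i then x else 0].

Lemma direct_sum_projections (I : choiceType) (U : I -> set M) :
  (forall i, submodule (U i)) -> direct_sum U -> exists p, projections U p.
Proof.
move=> sU dU; have [p pP] := choice dU.
have pE f x : (forall i, U i (f i)) -> finite_set [set i | f i != 0] ->
    x = \sum_(i \in [set: I]) f i -> p x = f.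
  by move=> Uf ff xE; case: (pP x) => _; apply.
exists (fun i x => p x i); split.
- move=> i a x y; suff -> : p (a *: x + y) = (fun i => a *: p x i + p y i) by [].
  have [[Ux fx xE] _] := pP x; have [[Uy fy yE] _] := pP y.
  have [s [us sx]] := finite_support_seq fx.
  have [t [ut ty]] := finite_support_seq fy.
  have xs j : p x j != 0 -> j \in undup (s ++ t).
    by move=> /sx js; rewrite mem_undup mem_cat js.
  have ys j : p y j != 0 -> j \in undup (s ++ t).
    by move=> /ty js; rewrite mem_undup mem_cat js orbT.
  have xys j : a *: p x j + p y j != 0 -> j \in undup (s ++ t).
    have [->|/xs//] := eqVneq (p x j) 0.
    by rewrite scaler0 add0r => /ys.
  apply: pE.
  + by move=> j; apply: submoduleD => //; apply: submoduleZ.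
  + exact: seq_finite_support xys.
  + rewrite (fsum_seq (undup_uniq _) xys) big_split /= -scaler_sumr.
    by rewrite -(fsum_seq (undup_uniq _) xs) -(fsum_seq (undup_uniq _) ys) -xE -yE.
- by move=> i x; have [[Ux _ _] _] := pP x.
- by move=> x; have [[_ ? _] _] := pP x.
- by move=> x; have [[_ _ ?] _] := pP x.
- move=> i j x Ux; rewrite (pE (fun j => if j == i then x else 0)) //.
  + by move=> k; case: eqP => [->//|_]; apply: submodule0.
  + by apply: (@seq_finite_support _ _ [:: i]) => k; rewrite inE; case: (k == i) => //; rewrite eqxx.
  + rewrite (@fsum_seq _ _ [:: i]) ?big_seq1 ?eqxx // => k.
    by rewrite inE; case: (k == i) => //; rewrite eqxx.
Qed.

Lemma projections_direct_sum (I : choiceType) (U : I -> set M) p :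
  (forall i, submodule (U i)) -> projections U p -> direct_sum U.
Proof.
move=> sU [lp Up fp pS pU] x; exists (fun i => p i x); split=> // f [Uf ff xE].
apply/funext => i; have [s [us sf]] := finite_support_seq ff.
pose q : {linear M -> M} := HB.pack (p i) (GRing.isLinear.Build S M M *:%R (p i) (lp i)).
have -> : p i x = \sum_(j <- s) p i (f j).
  by rewrite xE (fsum_seq us sf) -[p i]/(q : M -> M) linear_sum.
under eq_bigr => j _ do rewrite (pU j i _ (Uf j)).
have [is_|nis] := boolP (i \in s).
  rewrite (bigD1_seq i) //= eqxx big1 ?addr0 // => j ji.
  by rewrite eq_sym (negbTE ji).
have -> : f i = 0 by apply/eqP; apply: contraNT nis => /sf.
rewrite big1_seq // => j /andP[_ js]; case: eqP => // ij.
by rewrite ij js in nis.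
Qed.

End DirectSums.

Lemma column_projections (R D : pzRingType) n (rho : matrix_rep R D n)
    (N : lmodType D) (I : choiceType) (U : I -> set N) p :
  projections U p ->
  projections (fun i => [set x : column_module rho N | forall j, U i (x j)])
    (fun i => @column_map R D n rho N N (p i)).
Proof.
move=> [lp Up fp pS pU]; split=> /=.
- by move=> i; apply: column_map_linear.
- by move=> i x j; apply: Up.
- move=> x.
  have /choice[s sP] j := finite_support_seq (fp (x j)).
  apply: (@seq_finite_support _ _ (flatten [seq s j | j <- enum 'I_n])) => i pi0.
  have [j pj0] : exists j, p i (x j) != 0.
    apply: contrapT => /forallNP H; move/eqP: pi0; apply; apply/funext => j.
    by have /negP/negPn/eqP := H j.
  apply/flatten_mapP; exists j; first by rewrite mem_enum.
  by have [_] := sP j; apply.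
- move=> x.
  have /choice[s sP] j := finite_support_seq (fp (x j)).
  have xs i : column_map (p i) x != 0 :> column_module rho N ->
      i \in undup (flatten [seq s j | j <- enum 'I_n]).
    move=> pi0; rewrite mem_undup.
    have [j pj0] : exists j, p i (x j) != 0.
      apply: contrapT => /forallNP H; move/eqP: pi0; apply; apply/funext => j.
      by have /negP/negPn/eqP := H j.
    apply/flatten_mapP; exists j; first by rewrite mem_enum.
    by have [_] := sP j; apply.
  rewrite (fsum_seq (undup_uniq _) xs); apply/funext => j.
  rewrite [LHS](pS (x j)) fct_sumE; apply: fsum_seq; first exact: undup_uniq.
  move=> i pij; apply: xs; apply: contra_neq pij => /(congr1 (fun y => y j)).
  by [].
- move=> i j x Ux; apply/funext => k; rewrite /column_map (pU i j _ (Ux k)).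
  by case: eqP.
Qed.

Section Basis.
Context (D : pzRingType) (dD : division_ring D) (N : lmodType D).
Implicit Types (B : set N) (c : N -> D).

Definition combination B (x : N) : Prop :=
  exists (s : seq N) c, [/\ uniq s, forall b, b \in s -> B b
    & x = \sum_(b <- s) c b *: b].

Definition independent B : Prop :=
  forall (s : seq N) c, uniq s -> (forall b, b \in s -> B b) ->
  \sum_(b <- s) c b *: b = 0 -> forall b, b \in s -> c b = 0.

Lemma independent_span B y : independent B -> ~ combination B y ->
  independent (B `|` [set y]).
Proof.
move=> iB ny s c us sB s0.
have [ys|nys] := boolP (y \in s); last first.
  apply: iB => // b bs; case: (sB b bs) => // bE.
  by rewrite -bE bs in nys.
move: s0; rewrite (bigD1_seq y) //= -big_filter => s0.
have fB b : b \in [seq x <- s | x != y] -> B b.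
  by rewrite mem_filter => /andP[/eqP yb] /sB[].
have cy : c y = 0.
  apply: contra_notP ny => /eqP cy; have [d dc] := proj2 dD _ cy.
  exists [seq x <- s | x != y], (fun b => - d * c b); split=> //.
    exact: filter_uniq.
  under eq_bigr do rewrite -scalerA.
  rewrite -scaler_sumr scaleNr.
  have : d *: (c y *: y + \sum_(i <- [seq x <- s | x != y]) c i *: i) = 0.
    by rewrite s0 scaler0.
  by rewrite scalerDr scalerA dc scale1r => /eqP; rewrite addr_eq0 => /eqP.
move: s0; rewrite cy scale0r add0r => s0 b bs.
have [->//|yb] := eqVneq b y.
by apply: (iB _ c _ fB s0); rewrite ?filter_uniq // mem_filter yb.
Qed.

Lemma basis_exists B0 : independent B0 ->
  exists B, [/\ B0 `<=` B, independent B & forall x, combination B x].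
Proof.
move=> iB0.
have [|A [iA maxA]] := @Zorn_bigcup N [set A | independent (A `|` B0)].
  move=> F FI Ftot s c us sB.
  suff [A FA sA] : exists2 A, F A \/ A = set0 & forall b, b \in s -> (A `|` B0) b.
    by case: FA => [/FI iA|A0]; [exact: iA|apply: iB0 => // b /sA; rewrite A0 => -[]].
  elim: s sB {us} => [|b s IH] sB; first by exists set0 => //; right.
  have [|A FA sA] := IH; first by move=> x xs; apply: sB; rewrite inE xs orbT.
  case: (sB b) => [|[A' FA' A'b]|B0b]; first by rewrite inE eqxx.
  - have [A'A|AA'] : A' `<=` A \/ A `<=` A'.
      by case: FA => [FA|->]; [exact: Ftot|right].
    + exists A => // x; rewrite inE => /predU1P[->|/sA//]; left; exact: A'A.
    + exists A'; first by left.
      move=> x; rewrite inE => /predU1P[->|/sA[/AA'|]]; first by left.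
        by left.
      by right.
  - by exists A => // x; rewrite inE => /predU1P[->|/sA//]; right.
exists (A `|` B0); split=> // x; apply: contrapT => nx.
have Ax : A `<` A `|` [set x].
  split=> [y|]; first by left.
  move=> /(_ x) Ax; apply: nx; exists [:: x], (fun=> 1); split=> //.
    by move=> b; rewrite inE => /eqP ->; left; apply: Ax; right.
  by rewrite big_seq1 scale1r.
apply: (maxA _ Ax); rewrite /= setUAC.
exact: independent_span.
Qed.

Lemma basis_projections B : independent B -> (forall x, combination B x) ->
  exists p, projections
    (fun b : {b : N | b \in B} => [set x | exists d : D, x = d *: val b]) p.
Proof.
move=> iB sB; apply: direct_sum_projections.
  move=> b; apply/submoduleP; split; first by exists 0; rewrite scale0r.
    by move=> _ _ [d ->] [e ->]; exists (d + e); rewrite scalerDl.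
  by move=> a _ [d ->]; exists (a * d); rewrite scalerA.
move=> x; have [s [c [us sS ->]]] := sB x.
have [t tE] : exists t : seq {b : N | b \in B}, map val t = s.
  elim: s sS {us} => [|b s IH] sS; first by exists [::].
  have [|t <-] := IH; first by move=> y ys; apply: sS; rewrite inE ys orbT.
  have Bb : b \in B by rewrite inE; apply: sS; rewrite inE eqxx.
  by exists (exist _ b Bb :: t).
have ut : uniq t by rewrite -(map_inj_uniq val_inj) tE.
pose f b := if b \in t then c (val b) *: val b else 0.
have ft b : f b != 0 -> b \in t by rewrite /f; case: ifP => //; rewrite eqxx.
exists f; split.
  split.
  - move=> b; rewrite /f; case: ifP => _; first by exists (c (val b)).
    by exists 0; rewrite scale0r.
  - exact: seq_finite_support ft.
  - rewrite (fsum_seq ut ft) -tE big_map big_seq [RHS]big_seq.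
    by apply: eq_bigr => b bt; rewrite /f bt.
move=> g [/choice[e eE] fg gE]; apply/funext => b.
have [r [ur gr]] := finite_support_seq fg.
pose q := undup (t ++ r).
have uq : uniq q := undup_uniq _.
have fq b' : f b' != 0 -> b' \in q by move=> /ft bt; rewrite mem_undup mem_cat bt.
have gq b' : g b' != 0 -> b' \in q by move=> /gr bt; rewrite mem_undup mem_cat bt orbT.
pose c' (y : N) : D := if insub y is Some b then
   (if b \in t then c (val b) else 0) - e b else 0.
have c'E b' : c' (val b') *: val b' = f b' - g b'.
  rewrite /c' valK scalerBl -eE; congr (_ - _); rewrite /f.
  by case: ifP => // _; rewrite scale0r.
have s0 : \sum_(y <- map val q) c' y *: y = 0.
  rewrite big_map; under eq_bigr do rewrite c'E.
  rewrite sumrB -(fsum_seq uq fq) -(fsum_seq uq gq) -gE -tE big_map.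
  rewrite (fsum_seq ut ft) big_seq [X in _ - X]big_seq; apply/eqP; rewrite subr_eq0.
  by apply/eqP; apply: eq_bigr => b' bt; rewrite /f bt.
apply/eqP; rewrite -subr_eq0 -c'E.
have [bq|nbq] := boolP (b \in q).
  have uvq : uniq (map val q) by rewrite (map_inj_uniq val_inj).
  have Bvq y : y \in map val q -> B y.
    by move=> /mapP[z _ ->]; have := valP z; rewrite inE.
  by rewrite (iB _ c' uvq Bvq s0) ?scale0r // map_f.
rewrite c'E; have -> : f b = 0 by apply/eqP; apply: contraNT nbq => /fq.
have -> : g b = 0 by apply/eqP; apply: contraNT nbq => /gq.
by rewrite subr0.
Qed.

(** Complete [s] to a basis and read off the coordinate along [s]. *)
Lemma coordinate_functional (s : N) : s != 0 ->
  exists phi : N -> D^o, linear phi /\ phi s = 1.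
Proof.
move=> s0.
have sreg d : d *: s = 0 -> d = 0.
  move=> ds; apply: contra_neq_eq s0 => d0; have [e ed] := proj2 dD _ d0.
  by rewrite -[s]scale1r -ed -scalerA ds scaler0.
have iS : independent [set s].
  move=> [//|b [|b' t]] c ut ts.
    have bs : b = s by apply: ts; rewrite inE eqxx.
    by rewrite big_seq1 bs => /sreg cs b'; rewrite inE => /eqP ->.
  have bs : b = s by apply: ts; rewrite inE eqxx.
  have b's : b' = s by apply: ts; rewrite !inE eqxx orbT.
  by move: ut; rewrite bs b's /= inE eqxx.
have [B [sB iB spB]] := basis_exists iS.
have [p [lp Up _ _ pU]] := basis_projections iB spB.
have Bs : s \in B by rewrite inE; apply: sB.
pose s' : {b : N | b \in B} := exist _ s Bs.
have [phi phiE] := choice (Up s').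
exists phi; split.
  move=> a x y; apply/eqP; rewrite -subr_eq0; apply/eqP/sreg.
  rewrite scalerBl -(phiE (a *: x + y) : _ = _ *: s) scalerDl -[(a *: (phi x : D^o))]/(a * phi x).
  by rewrite -scalerA -!(phiE : forall x, p s' x = phi x *: s) lp subrr.
apply/eqP; rewrite -subr_eq0; apply/eqP/sreg.
rewrite scalerBl scale1r -[X in _ *: X]/(val s') -phiE (pU s') ?eqxx ?subrr //.
by exists 1; rewrite scale1r.
Qed.

End Basis.

(** * Endofinite modules and matrix representations *)

Definition has_endofinite (R : pzRingType) : Prop :=
  exists V : lmodType R, (exists x : V, x != 0) /\ exists n, endolength_at_most V n.

Section MinimalEndolength.
Context (R : pzRingType) (V : lmodType R) (n : nat).
Hypothesis V0 : exists x : V, x != 0.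
Hypothesis Vn : endolength_at_most V n.
Hypothesis Vmin : forall (W : lmodType R) m, (exists x : W, x != 0) ->
  endolength_at_most W m -> (n <= m)%N.

Let EV : lmodType (endo V) := endo_module V.

(** The heights of the [End V]-submodules of [U] also bound the length of [U] over
    its own endomorphisms, since [End V] acts on [U] through them; for proper [U]
    that bound is below the minimal one. *)
Lemma minimal_bisubmodule (U : set V) : submodule U -> @submodule _ EV U ->
  (exists2 x, U x & x != 0) -> U = [set: V].
Proof.
move=> sU eU [x Ux x0]; have [mu [mun mulT]] := Vn.
apply: contrapT => UT.
have Ux' : x \in [in U] by rewrite inE.
suff nU : (n <= mu U)%N.
  have UT' : (mu U < mu setT)%N.
    by apply: mulT => //; [exact: submodule_setT|
      split=> // TU; apply: UT; apply/seteqP].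
  have := leq_trans UT' (mun setT (@submodule_setT _ EV)).
  by rewrite ltnNge nU.
apply: (Vmin (W := submod_type sU)).
  by exists (exist _ x Ux'); apply: contra_neq x0 => /(congr1 val).
(* An endomorphism of [V] restricts to one of [U], because [U] is [End V]-stable. *)
have sub X : @submodule _ (endo_module (submod_type sU)) X ->
    @submodule _ EV [set val y | y in X].
  move=> sX; apply/submoduleP; split.
  - by exists 0 => //; exact: submodule0.
  - by move=> _ _ [y Xy <-] [z Xz <-]; exists (y + z) => //; exact: submoduleD.
  - move=> c _ [y Xy <-].
    have [f fE] : exists f : submod_type sU -> submod_type sU,
        forall z, val (f z) = endo_fun c (val z).
      have /choice[f fE] : forall z : submod_type sU, exists w : submod_type sU,
          val w = endo_fun c (val z).
        move=> z; apply: submod_type_ex; exact: (submoduleZ c eU (submod_typeP z)).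
      by exists f.
    have [|e eE] := @endo_ex R (submod_type sU) f.
      move=> a z w; apply: val_inj.
      by rewrite fE /= !linearP -!fE.
    exists (endo_fun e y); first exact: (submoduleZ e sX Xy).
    by rewrite eE fE.
exists (fun X => mu [set val y | y in X]); split=> [X sX|X Y sX sY [XY YX]].
  have XU : [set val y | y in X] `<=` U by move=> _ [y _ <-]; exact: submod_typeP.
  have [->//|nXU] := pselect ([set val y | y in X] = U).
  apply/ltnW/mulT => //; first exact: sub.
  by split=> // UX; apply: nXU; apply/seteqP.
apply: mulT; [exact: sub|exact: sub|split].
  by move=> _ [y Xy <-]; exists y => //; exact: XY.
move=> YX'; apply: YX => y Yy.
have [|z Xz /val_inj <-//] := YX' (val y).
by exists y.
Qed.

Lemma simple_endo_submodule : exists S : set V,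
  [/\ @submodule _ EV S, exists2 x, S x & x != 0
    & forall X, @submodule _ EV X -> X `<=` S -> (exists2 x, X x & x != 0) -> X = S].
Proof.
have [mu [mun mulT]] := Vn.
pose P k := `[< exists X, [/\ @submodule _ EV X, exists2 x, X x & x != 0 & mu X = k] >].
have exP : exists k, P k.
  have [x x0] := V0; exists (mu setT); apply/asboolP; exists setT; split=> //.
    exact: submodule_setT.
  by exists x.
case: (ex_minnP exP) => _ /asboolP[S [sS S0 <-]] minS.
exists S; split=> // X sX XS X0; apply: contrapT => nXS.
have : (mu X < mu S)%N by apply: mulT => //; split=> // SX; apply: nXS; apply/seteqP.
by rewrite ltnNge minS //; apply/asboolP; exists X.
Qed.

Section Frame.
Context (S : set V).
Hypothesis sS : @submodule _ EV S.
Hypothesis Snz : exists2 x, S x & x != 0.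
Hypothesis Smin : forall X, @submodule _ EV X -> X `<=` S ->
  (exists2 x, X x & x != 0) -> X = S.

(** Coefficients [r] for which the sum of the [r j S] is direct and each
    [r j S] is a copy of [S]. *)
Definition frame (r : nat -> R) (m : nat) := forall x : nat -> V,
  (forall j, S (x j)) -> \sum_(j < m) r j *: x j = 0 ->
  forall j, (j < m)%N -> x j = 0.

Definition frame_span (r : nat -> R) (m : nat) : set V :=
  [set v | exists2 x : nat -> V, forall j, S (x j) & v = \sum_(j < m) r j *: x j].

Lemma endo_sum (c : endo V) (r : nat -> R) (m : nat) (x : nat -> V) :
  endo_fun c (\sum_(j < m) r j *: x j) = \sum_(j < m) r j *: endo_fun c (x j).
Proof. by rewrite linear_sum; apply: eq_bigr => j _; rewrite linearZ. Qed.

Lemma frame_span_submodule r m : @submodule _ EV (frame_span r m).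
Proof.
apply/submoduleP; split.
- exists (fun=> 0); first by move=> j; exact: (submodule0 sS).
  by rewrite big1 // => j _; rewrite scaler0.
- move=> _ _ [x Sx ->] [y Sy ->]; exists (fun j => x j + y j).
    by move=> j; exact: (submoduleD sS).
  by rewrite -big_split; apply: eq_bigr => j _; rewrite scalerDr.
- move=> c _ [x Sx ->]; exists (fun j => endo_fun c (x j)).
    by move=> j; exact: (submoduleZ c sS).
  by rewrite -endo_sum.
Qed.

(** Each new term of a frame enlarges the span, so the length of [V] bounds the
    size of frames. *)
Lemma frame_height (mu : set V -> nat) :
  (forall X Y, @submodule _ EV X -> @submodule _ EV Y -> X `<` Y -> (mu X < mu Y)%N) ->
  forall r m, frame r m -> (m <= mu (frame_span r m))%N.
Proof.
move=> mulT r; elim=> [//|m IH] fr.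
have fr' : frame r m.
  move=> x Sx x0 j jm.
  have := fr (fun k => if (k < m)%N then x k else 0); rewrite big_ord_recr /= ltnn scaler0 addr0.
  move=> /(_ _ _ j); rewrite jm; apply.
  - by move=> k; case: ifP => // _; exact: (submodule0 sS).
  - by rewrite -[RHS]x0; apply: eq_bigr => k _; rewrite ltn_ord.
  - exact: ltnW.
apply: (leq_ltn_trans (IH fr')); apply: mulT; [exact: frame_span_submodule..|].
split=> [_ [x Sx ->]|sub].
  exists (fun k => if (k < m)%N then x k else 0).
    by move=> k; case: ifP => // _; exact: (submodule0 sS).
  rewrite big_ord_recr /= ltnn scaler0 addr0.
  by apply: eq_bigr => k _; rewrite ltn_ord.
have [s Ss s0] := Snz.
have [|x Sx xE] := sub (r m *: s).
  exists (fun k => if (k < m)%N then 0 else s).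
    by move=> k; case: ifP => // _; exact: (submodule0 sS).
  rewrite big_ord_recr /= ltnn big1 ?add0r // => k _.
  by rewrite ltn_ord scaler0.
have := fr (fun k => if (k < m)%N then x k else - s).
rewrite big_ord_recr /= ltnn scalerN xE => /(_ _ _ m); rewrite ltnn => H.
have /eqP : - s = 0.
  apply: H => //.
    by move=> k; case: ifP => // _; exact: (submoduleN sS).
  apply/eqP; rewrite subr_eq0; apply/eqP.
  by apply: eq_bigr => k _; rewrite ltn_ord.
by rewrite oppr_eq0 (negbTE s0).
Qed.

(** Take a frame of maximal size.  If [a s] lies outside its span for some [a] and
    some [s] in [S], then no nonzero element of [S] is sent by [a] into the span,
    by simplicity, and [a] extends the frame.  Hence the span is stable under [R]
    as well as under [End V], and [minimal_bisubmodule] applies. *)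
Lemma full_frame : exists r m, [/\ (0 < m)%N, frame r m & forall v, frame_span r m v].
Proof.
have [mu [mun mulT]] := Vn.
pose P m := `[< exists r, frame r m >].
have P1 : P 1%N.
  apply/asboolP; exists (fun=> 1) => x Sx; rewrite big_ord1 scale1r => x0 [|//] _.
  exact: x0.
have Pn m : P m -> (m <= n)%N.
  move=> /asboolP[r fr]; apply: leq_trans (mun _ (frame_span_submodule r m)).
  exact: frame_height.
case: (ex_maxnP (ex_intro P _ P1) Pn) => m /asboolP[r fr] maxm.
exists r, m; split=> //; first exact: maxm.
have sX := frame_span_submodule r m.
have absorb a s : S s -> frame_span r m (a *: s).
  move=> Ss; pose Y := [set s | S s /\ frame_span r m (a *: s)].
  suff YS : Y = S by move: Ss; rewrite -YS => -[].
  apply: Smin; last 1 first.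
  - pose r' k := if (k < m)%N then r k else a.
    (* A relation that witnesses this failure involves a nonzero [x m], which is in [Y]. *)
    have : ~ frame r' m.+1.
      move=> fr'; suff : (m.+1 <= m)%N by rewrite ltnn.
      by apply: maxm; apply/asboolP; exists r'.
    move=> /existsNP[x] /not_implyP[Sx] /not_implyP[]; rewrite big_ord_recr /= /r' ltnn.
    under eq_bigr => k _ do rewrite ltn_ord.
    move=> x0 xn0; exists (x m); first split=> //.
      rewrite (_ : a *: x m = \sum_(j < m) r j *: - x j).
        by exists (fun j => - x j) => // j; exact: (submoduleN sS).
      move/eqP: x0; rewrite addrC addr_eq0 => /eqP ->.
      by rewrite -sumrN; apply: eq_bigr => j _; rewrite scalerN.
    apply: contra_notN xn0 => /eqP xm0 j; rewrite ltnS leq_eqVlt => /predU1P[->//|].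
    by move: x0; rewrite xm0 scaler0 addr0 => /fr; exact.
  - apply/submoduleP; split.
    + split; first exact: (submodule0 sS).
      by rewrite scaler0; exact: (submodule0 sX).
    + move=> s1 s2 [S1 X1] [S2 X2]; split; first exact: (submoduleD sS).
      by rewrite scalerDr; exact: (submoduleD sX).
    + move=> c s1 [S1 X1]; split; first exact: (submoduleZ c sS).
      have := submoduleZ c sX X1.
      by rewrite -[c *: _]/(endo_fun c (a *: s1)) linearZ.
  - by move=> ? [].
move=> v; suff -> : frame_span r m = setT by [].
apply: minimal_bisubmodule => //.
  apply/submoduleP; split; [exact: (submodule0 sX)| |].
    by move=> x y; exact: (submoduleD sX).
  move=> a _ [x Sx ->]; rewrite scaler_sumr.
  under eq_bigr do rewrite scalerA.
  by apply: (submodule_sum _ sX) => j _; exact: absorb.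
have [s Ss s0] := Snz; exists s => //.
by rewrite -[s]scale1r; exact: absorb.
Qed.

Section Coordinates.
Context (r : nat -> R) (m : nat).
Hypothesis m0 : (0 < m)%N.
Hypothesis fr : frame r m.
Hypothesis full : forall v, frame_span r m v.

Let Sm : lmodType (endo V) := submod_type sS.
Let N : lmodType (endo Sm) := endo_module Sm.

Definition assemble (x : 'I_m -> Sm) : V := \sum_(j < m) r j *: val (x j).

Lemma assemble_inj : injective assemble.
Proof.
move=> x y xy.
pose z k := if insub k is Some j then val (x j - y j) : V else 0.
have zE (j : 'I_m) : z j = val (x j - y j) by rewrite /z valK.
have Sz k : S (z k).
  by rewrite /z; case: insub => [j|]; [exact: submod_typeP|exact: (submodule0 sS)].
have /(_ Sz) z0 := fr (x := z).
apply/funext => j; apply/eqP; rewrite -subr_eq0 -(inj_eq val_inj) -zE z0 //.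
under eq_bigr => k _ do rewrite zE /= scalerBr.
by apply/eqP; rewrite sumrB subr_eq0; apply/eqP.
Qed.

Lemma assemble_surj v : exists x, assemble x = v.
Proof.
have [x Sx ->] := full v.
have /choice[y yE] : forall j : 'I_m, exists s : Sm, val s = x j.
  by move=> j; exact: submod_type_ex.
by exists y; apply: eq_bigr => j _; rewrite yE.
Qed.

Lemma assemble_additive x y : assemble (x + y) = assemble x + assemble y.
Proof. by rewrite -big_split; apply: eq_bigr => j _; rewrite /= -scalerDr. Qed.

(** Endomorphisms of [V] commute with the [r j], so they act on [V = S^m] by one
    and the same map on each coordinate. *)
Lemma assemble_endo (c : endo V) x :
  assemble (fun j => c *: x j) = endo_fun c (assemble x).
Proof.
by rewrite /assemble linear_sum; apply: eq_bigr => j _; rewrite [RHS]linearZ.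
Qed.

(** This is Schur's lemma. *)
Lemma endo_division : division_ring (endo Sm).
Proof.
have [s Ss s0] := Snz; have [s' s'E] := submod_type_ex sS Ss.
have s'0 : s' != 0 by rewrite -(inj_eq val_inj) s'E.
split=> [|d d0].
  apply: contra_neq s'0 => /(congr1 (fun d : endo Sm => endo_fun d s')).
  by rewrite endo_oneE => ->.
have [t dt0] : exists t, endo_fun d t != 0.
  apply: contrapT => /forallNP H; move/eqP: d0; apply; apply: endo_ext => t.
  by have /negP/negPn/eqP := H t.
have sub_val (X : set Sm) : submodule X -> @submodule _ EV [set val y | y in X].
  move=> sX; apply/submoduleP; split.
  - by exists 0 => //; exact: submodule0.
  - by move=> _ _ [y Xy <-] [z Xz <-]; exists (y + z) => //; exact: submoduleD.
  - by move=> c _ [y Xy <-]; exists (c *: y) => //; exact: submoduleZ.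
have val_sub (X : set Sm) : [set val y | y in X] `<=` S.
  by move=> _ [y _ <-]; exact: submod_typeP.
have simp (X : set Sm) : submodule X -> (exists2 x, X x & x != 0) -> forall x, X x.
  move=> sX [y Xy y0] x.
  have XS := Smin (sub_val X sX) (val_sub X) (ex_intro2 _ _ (val y) (imageP val Xy) y0).
  have : [set val y | y in X] (val x) by rewrite XS; exact: submod_typeP.
  by case=> z Xz /val_inj <-.
have dsurj y : exists x, endo_fun d x = y.
  apply: (simp [set y | exists x, endo_fun d x = y]); last first.
    by exists (endo_fun d t) => //; exists t.
  apply/submoduleP; split; first by exists 0; rewrite linear0.
    by move=> _ _ [x <-] [y' <-]; exists (x + y'); rewrite linearD.
  by move=> c _ [x <-]; exists (c *: x); rewrite linearZ.
have dinj x : endo_fun d x = 0 -> x = 0.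
  move=> dx; apply: contra_neq_eq dt0 => x0.
  apply: (simp [set x | endo_fun d x = 0]); last by exists x.
  apply/submoduleP; split=> [|y z /= yE zE|c y /= yE]; first exact: linear0.
    by rewrite linearD yE zE addr0.
  by rewrite linearZ /= yE scaler0.
have /choice[g gE] := dsurj.
have [|e eE] := @endo_ex _ Sm g.
  move=> a x y; apply/eqP; rewrite -subr_eq0; apply/eqP/dinj.
  by rewrite linearB linearP !gE subrr.
exists e; apply: endo_ext => x; rewrite endo_mulE eE endo_oneE.
by apply/eqP; rewrite -subr_eq0; apply/eqP/dinj; rewrite linearB gE subrr.
Qed.

(** The [i]-th coordinate of [a (r_j s)], as a function of [s] in [S], is
    [End V]-linear: it is the [(i, j)] entry of the matrix of [a]. *)
Lemma coordinate_matrix_rep : exists rho : matrix_rep R (endo Sm) m,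
  forall a (x : column_module rho N), assemble (a *: x) = a *: assemble x.
Proof.
have /choice[coord coordE] := assemble_surj.
have coordD v w : coord (v + w) = coord v + coord w.
  by apply: assemble_inj; rewrite assemble_additive !coordE.
have coordZ (c : endo V) v j : coord (endo_fun c v) j = c *: coord v j.
  suff -> : coord (endo_fun c v) = (fun j => c *: coord v j) by [].
  by apply: assemble_inj; rewrite assemble_endo !coordE.
have /choice[M ME] : forall aij : R * 'I_m * 'I_m, exists d : endo Sm, forall s : Sm,
    endo_fun d s = coord (aij.1.1 *: (r aij.2 *: val s)) aij.1.2.
  move=> [[a i] j] /=; apply: endo_ex => c s t.
  rewrite /= -coordZ !scalerDr coordD; congr (_ + _).
  by congr (coord _ i); rewrite -[endo_fun c _]/(endo_fun c _) !linearZ.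
pose rho a := \matrix_(i, j) M (a, i, j).
have rhoE a (x : 'I_m -> Sm) :
    assemble (fun i => \sum_j rho a i j *: (x j : N)) = a *: assemble x.
  rewrite -[RHS]coordE; congr assemble; apply/funext => i.
  have -> : coord (a *: assemble x) i = \sum_(j < m) coord (a *: (r j *: val (x j))) i.
    rewrite /assemble scaler_sumr.
    apply: (big_morph (fun v => coord v i)) => [v w|]; first by rewrite coordD.
    by have := coordZ 0 0 i; rewrite scale0r.
  by apply: eq_bigr => j _; rewrite mxE -[LHS]/(endo_fun (M (a, i, j)) (x j)) ME.
have matI (A B : 'M[endo Sm]_m) :
    (forall (x : 'I_m -> Sm) i, \sum_j A i j *: (x j : N) = \sum_j B i j *: (x j : N)) -> A = B.
  move=> AB; apply/matrixP => i j; apply: endo_ext => s.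
  have := AB (fun k => if k == j then s else 0) i.
  rewrite (bigD1 j) //= eqxx big1 ?addr0; last first.
    by move=> k /negbTE ->; rewrite scaler0.
  rewrite (bigD1 j) //= eqxx big1 ?addr0 // => k /negbTE ->.
  by rewrite scaler0.
have rhoI (A : 'M[endo Sm]_m) a :
    (forall x : 'I_m -> Sm, assemble (fun i => \sum_j A i j *: (x j : N)) = a *: assemble x) ->
    rho a = A.
  move=> AE; apply: matI => x i.
  suff /(congr1 (fun f => f i)) : (fun i => \sum_j rho a i j *: (x j : N))
     = (fun i => \sum_j A i j *: (x j : N)) by [].
  by apply: assemble_inj; rewrite rhoE AE.
have rhoD a b : rho (a + b) = rho a + rho b.
  apply: rhoI => x; rewrite scalerDl -!rhoE -assemble_additive; congr assemble.
  apply/funext => i; rewrite -[RHS]/(_ + _) -big_split; apply: eq_bigr => j _.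
  by rewrite mxE scalerDl.
have rhoM a b : rho (a * b) = rho a *m rho b.
  apply: rhoI => x; rewrite -scalerA -(rhoE b) -rhoE; congr assemble.
  apply/funext => i.
  under [RHS]eq_bigr do rewrite scaler_sumr.
  rewrite exchange_big /=; apply: eq_bigr => j _.
  by rewrite mxE scaler_suml; apply: eq_bigr => k _; rewrite scalerA.
have rho1 : rho 1 = 1%:M.
  apply: rhoI => x; rewrite scale1r; congr assemble; apply/funext => i.
  rewrite (bigD1 i) //= big1 ?mxE ?eqxx ?scale1r ?addr0 // => j ji.
  by rewrite mxE eq_sym (negbTE ji) scale0r.
by exists (MatrixRep rhoD rhoM rho1).
Qed.

(** Let [e] be the projection of [D^m] on [U] along [W].  With [h : D -> S],
    [d |-> d s], and a [D]-linear [p : S -> D] such that [p s = 1], the map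
    [h^m e p^m] of [S^m = V] is [R]-linear, hence given by one element [c] of
    [End V] on each coordinate.  Since [p h = 1], [e] acts on each coordinate as
    [d |-> p (c (d s)) = d p (c s)], that is, as right multiplication by
    [q = p (c s)]; and an idempotent [q] of a division ring is [0] or [1]. *)
Lemma column_indecomposable (rho : matrix_rep R (endo Sm) m) :
  (forall a (x : column_module rho N), assemble (a *: x) = a *: assemble x) ->
  indecomposable (column_module rho (endo Sm)^o).
Proof.
move=> rhoV; have dD := endo_division; split; first exact: column_nonzero.
move=> U W sU sW UW UWT.
have [s Ss s0] := Snz; have [s' s'E] := submod_type_ex sS Ss.
have s'0 : s' != 0 by rewrite -(inj_eq val_inj) s'E.
have [p [lp p1]] := coordinate_functional (N := N) dD s'0.
pose h (d : (endo Sm)^o) : N := d *: (s' : N).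
have lh : linear h by move=> a d e; rewrite /h scalerDl -scalerA.
pose pl : {linear N -> (endo Sm)^o} :=
  HB.pack p (GRing.isLinear.Build (endo Sm) N (endo Sm)^o *:%R p lp).
have pZ d t : p (d *: t) = d * p t by rewrite -[p]/(pl : _ -> _) linearZ.
have ph d : p (h d) = d by rewrite pZ p1 mulr1.
pose C := column_module rho (endo Sm)^o.
have /choice[e eP] : forall x : C, exists u, U u /\ W (x - u).
  by move=> x; have [u [w [Uu Ww ->]]] := UWT x; exists u; rewrite addrC addKr.
have eE x u : U u -> W (x - u) -> e x = u.
  move=> Uu Wu; have [Ue We] := eP x; apply/eqP; rewrite -subr_eq0; apply/eqP.
  suff : (U `&` W) (e x - u) by rewrite UW.
  split; first exact: submoduleB.
  have -> : e x - u = (x - u) - (x - e x) by rewrite opprB [RHS]addrC addrA subrK.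
  exact: submoduleB.
have le : linear e.
  move=> a x y; have [[Ux Wx] [Uy Wy]] := (eP x, eP y); apply: eE.
    by apply: submoduleD => //; exact: submoduleZ.
  rewrite opprD addrACA -scalerBr.
  by apply: submoduleD => //; exact: submoduleZ.
have /choice[dis disE] := assemble_surj.
have ldis (a : R) v w :
    dis (a *: v + w) = (a *: (dis v : column_module rho N) + (dis w : column_module rho N)).
  by apply: assemble_inj; rewrite assemble_additive rhoV !disE.
pose g v := assemble (column_map (rho := rho) h (e (column_map (rho := rho) p (dis v)))).
have [|c cE] := @endo_ex R V g.
  move=> a v w; rewrite /g ldis (column_map_linear (rho := rho) lp) le.
  by rewrite (column_map_linear (rho := rho) lh) assemble_additive rhoV.
pose q := p (@GRing.scale _ Sm c s').
have eq_ (y : C) i : e y i = y i * q.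
  have : assemble (column_map (rho := rho) h (e y)) =
         assemble (fun j => @GRing.scale _ Sm c (h (y j))).
    rewrite assemble_endo cE /g.
    have -> : dis (assemble (fun j => h (y j))) = (fun j => h (y j)).
      by apply: assemble_inj; rewrite disE.
    have -> // : column_map (rho := rho) p (fun j => h (y j)) = y.
    by apply/funext => j; rewrite /column_map ph.
  move=> /assemble_inj/(congr1 (fun f => f i)); rewrite /column_map => hE.
  rewrite -[LHS]ph hE -pZ; congr p.
  by rewrite /h -[RHS]/(endo_fun (y i) (@GRing.scale _ Sm c s')) linearZ.
have qq : q = 0 \/ q = 1.
  pose y : C := fun=> 1; have [Uy _] := eP y.
  have : e (e y) = e y by apply: eE => //; rewrite subrr; exact: submodule0.
  move=> /(congr1 (fun f => f (Ordinal m0))); rewrite !eq_ mul1r => qq.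
  have [->|q0] := eqVneq q 0; [by left|right].
  have [z [zq _]] := division_ringV dD q0.
  by rewrite -[LHS]mul1r -zq -mulrA qq.
case: qq => qE; [left|right]; apply/seteqP; split=> x; last 1 first.
- by move=> ->; exact: submodule0.
- move=> Ux /=; rewrite -(eE x x Ux) ?subrr; last exact: submodule0.
  by apply/funext => i; rewrite eq_ qE mulr0.
- by move=> ->; exact: submodule0.
- move=> Wx /=; have -> : x = e x by apply/funext => i; rewrite eq_ qE mulr1.
  by apply: eE; [exact: submodule0|rewrite subr0].
Qed.

End Coordinates.

End Frame.

End MinimalEndolength.

(** Both conclusions come from one nonzero module of least endolength. *)
Lemma endofinite_structure (R : pzRingType) : has_endofinite R ->
  (exists2 m, (0 < m)%N & represented R m) /\
  (exists V : lmodType R, indecomposable V /\ endofinite V).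
Proof.
move=> [V0 [nzV0 [n0 Vn0]]].
pose P n := `[< exists V : lmodType R, (exists x : V, x != 0) /\ endolength_at_most V n >].
have exP : exists n, P n by exists n0; apply/asboolP; exists V0.
case: (ex_minnP exP) => n /asboolP[V [nzV Vn]] minn.
have Vmin (W : lmodType R) m : (exists x : W, x != 0) -> endolength_at_most W m -> (n <= m)%N.
  by move=> W0 Wm; apply: minn; apply/asboolP; exists W.
have [S [sS Snz Smin]] := simple_endo_submodule nzV Vn.
have [r [m [m0 fr full]]] := full_frame Vn Vmin sS Snz Smin.
have [rho rhoV] := coordinate_matrix_rep sS fr full.
have dD := endo_division sS Snz Smin.
split; first by exists m => //; exists (endo (submod_type sS)); split.
exists (column_module rho (endo (submod_type sS))^o); split.
  exact: (column_indecomposable Snz Smin m0 fr full rhoV).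
exact: length_finite (column_endolength rho dD).
Qed.

Lemma represented_endofinite (R : pzRingType) m :
  (0 < m)%N -> represented R m -> has_endofinite R.
Proof.
move=> m0 [D [dD [rho]]]; exists (column_module rho D^o); split.
  exact: column_nonzero.
by exists m; exact: column_endolength.
Qed.

Lemma indecomposable_endofinite (R : pzRingType) (V : lmodType R) :
  indecomposable V -> endofinite V -> has_endofinite R.
Proof.
move=> [V0 _] [n [U nU]]; exists V; split=> //; exists n.
exact: composition_series_length nU.
Qed.

(** * Additive relations and Serre orders *)

Section Relations.
Context (R : pzRingType) (A : lmodType R).
Implicit Types (rho sigma tau : A -> A -> Prop) (phi psi chi : set A).

Definition converse rho x y := rho y x.
Definition compose rho sigma x z := exists2 y, rho x y & sigma y z.
Definition meet rho sigma x y := rho x y /\ sigma x y.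
Definition rel_sum rho sigma x y :=
  exists y1 y2, [/\ rho x y1, sigma x y2 & y = y1 + y2].
Definition graph (a : R) (x y : A) := y = a *: x.

Definition image_of rho phi : set A := [set y | exists2 x, phi x & rho x y].
Definition domain rho : set A := [set x | exists y, rho x y].
(** For an additive relation, the values at one point form a coset of the values
    at [0]. *)
Definition indeterminacy rho : set A := rho 0.

(** The closure properties of the relations defined by positive primitive formulas:
    together they make definable subquotients behave as an abelian category. *)
Record calculus (good : (A -> A -> Prop) -> Prop) : Prop := Calculus {
  calc_0 : forall rho, good rho -> rho 0 0 ;
  calc_sub : forall rho, good rho ->
    forall x y x' y', rho x y -> rho x' y' -> rho (x - x') (y - y') ;
  calc_top : good (fun _ _ => True) ;
  calc_graph : forall a, good (graph a) ;
  calc_conv : forall rho, good rho -> good (converse rho) ;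
  calc_comp : forall rho sigma, good rho -> good sigma -> good (compose rho sigma) ;
  calc_meet : forall rho sigma, good rho -> good sigma -> good (meet rho sigma) ;
  calc_sum : forall rho sigma, good rho -> good sigma -> good (rel_sum rho sigma) }.

Section Calculus.
Context (good : (A -> A -> Prop) -> Prop) (cG : calculus good).

(** Definable subgroups are encoded as relations, so that one list of closure
    properties serves both. *)
Definition gset phi := good (fun _ y => phi y).

Lemma eq_good rho sigma : (forall x y, rho x y <-> sigma x y) -> good rho -> good sigma.
Proof.
move=> e; suff -> : rho = sigma by [].
by apply/funext => x; apply/funext => y; apply/propext.
Qed.

Lemma good_add rho x y x' y' : good rho -> rho x y -> rho x' y' -> rho (x + x') (y + y').
Proof.
move=> g xy xy'; rewrite -[x']opprK -[y']opprK.
apply: (calc_sub cG) => //; rewrite -[- x']sub0r -[- y']sub0r.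
by apply: (calc_sub cG) => //; exact: (calc_0 cG).
Qed.

Lemma gset_0 phi : gset phi -> phi 0.
Proof. exact: (calc_0 cG). Qed.
Lemma gset_sub phi x y : gset phi -> phi x -> phi y -> phi (x - y).
Proof. by move=> g px py; exact: (calc_sub cG g (x := 0) (x' := 0) px py). Qed.
Lemma gset_add phi x y : gset phi -> phi x -> phi y -> phi (x + y).
Proof. by move=> g px py; exact: (good_add (x := 0) (x' := 0) g px py). Qed.

Lemma gsetT : gset setT.
Proof. exact: (calc_top cG). Qed.

Lemma gset_set0 : gset [set 0].
Proof.
by apply: eq_good (calc_graph cG 0) => x y; rewrite /graph scale0r.
Qed.

Lemma gset_image rho phi : good rho -> gset phi -> gset (image_of rho phi).
Proof. by move=> gr gp; apply: (calc_comp cG gp gr). Qed.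

Lemma gset_domain rho : good rho -> gset (domain rho).
Proof.
move=> gr; apply: eq_good (gset_image (calc_conv cG gr) gsetT) => x y.
by split=> [[z _ yz]|[z yz]]; exists z.
Qed.

Lemma gset_indeterminacy rho : good rho -> gset (indeterminacy rho).
Proof.
move=> gr; apply: eq_good (gset_image gr gset_set0) => x y.
by split=> [[_ ->]|yz] //; exists 0.
Qed.

Lemma gsetI phi psi : gset phi -> gset psi -> gset (phi `&` psi).
Proof. by move=> gp gq; apply: (calc_meet cG gp gq). Qed.

Definition restriction phi := meet (graph 1) (fun _ y => phi y).

Lemma good_restriction phi : gset phi -> good (restriction phi).
Proof. by move=> gp; apply: (calc_meet cG) gp; exact: (calc_graph cG). Qed.

Lemma image_restriction phi psi : image_of (restriction psi) phi = phi `&` psi.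
Proof.
apply/seteqP; split=> [y [x px [+ py]]|y [px py]].
  by rewrite /graph scale1r => yx; rewrite -yx in px.
by exists y => //; split; rewrite // /graph scale1r.
Qed.

(** The image of [psi] under the translation by [phi] is [psi + phi]. *)
Definition translation phi := rel_sum (graph 1) (fun _ y => phi y).

Lemma good_translation phi : gset phi -> good (translation phi).
Proof. by move=> gp; apply: (calc_sum cG) gp; exact: (calc_graph cG). Qed.

Lemma translationE phi x y : translation phi x y <-> phi (y - x).
Proof.
split=> [[y1 [y2 [-> py2 ->]]]|pyx]; first by rewrite scale1r addrC addKr.
by exists x, (y - x); split; rewrite // /graph ?scale1r // addrC subrK.
Qed.

(** [P (phi, psi)] reads: [phi] is contained in [psi] up to a small subquotient.
    Stability under images makes smallness of [phi / psi] invariant under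
    definable isomorphism, so that such orders correspond to the Serre
    subcategories of the category of definable subquotients. *)
Record serre (P : set (set A * set A)) : Prop := Serre {
  serre_gset : forall phi psi, P (phi, psi) -> gset phi /\ gset psi ;
  serre_sub : forall phi psi, gset phi -> gset psi -> phi `<=` psi -> P (phi, psi) ;
  serre_trans : forall phi psi chi, P (phi, psi) -> P (psi, chi) -> P (phi, chi) ;
  serre_image : forall rho phi psi, good rho -> P (phi, psi) ->
    P (image_of rho phi, image_of rho psi) }.

Definition proper_serre P := serre P /\ ~ P (setT, [set 0]).

(** Properness only concerns one pair, so it survives unions of chains. *)
Lemma maximal_serre P0 : proper_serre P0 ->
  exists P, [/\ proper_serre P, P0 `<=` P
    & forall Q, serre Q -> P `<=` Q -> ~ Q `<=` P -> Q (setT, [set 0])].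
Proof.
move=> pP0.
(* The empty set is admitted so that the empty chain has an upper bound. *)
have [|P [PP maxP]] := @Zorn_bigcup _
    [set P | P = set0 \/ (proper_serre P /\ P0 `<=` P)].
  move=> F FP Ftot.
  have [[Q FQ Q0]|nF] := pselect (exists2 Q, F Q & Q <> set0); last first.
    left; apply/seteqP; split=> // x [Q FQ Qx].
    by apply: nF; exists Q => // Q0; move: Qx; rewrite Q0.
  have ser Q' x : F Q' -> Q' x -> proper_serre Q' /\ P0 `<=` Q'.
    by move=> FQ' Q'x; have [Q'0|//] := FP _ FQ'; move: Q'x; rewrite Q'0.
  have [[sQ _] P0Q] : proper_serre Q /\ P0 `<=` Q by have [//|] := FP _ FQ.
  right; split; last by move=> x P0x; exists Q => //; exact: P0Q.
  split; last by move=> [Q' FQ' Q'x]; have [[_ +] _] := ser _ _ FQ' Q'x.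
  split.
  - by move=> phi psi [Q' FQ' Q'x]; have [[[+ _ _ _] _] _] := ser _ _ FQ' Q'x; apply.
  - by move=> phi psi gphi gpsi sub; exists Q => //; exact: (serre_sub sQ).
  - move=> phi psi chi [Q1 F1 Q1x] [Q2 F2 Q2x].
    have [[s1 _] _] := ser _ _ F1 Q1x; have [[s2 _] _] := ser _ _ F2 Q2x.
    have [sub|sub] := Ftot _ _ F1 F2.
    + by exists Q2 => //; apply: (serre_trans s2) Q2x; exact: sub.
    + by exists Q1 => //; apply: (serre_trans s1 Q1x); exact: sub.
  - move=> rho phi psi gr [Q' FQ' Q'x]; exists Q' => //.
    by have [[[_ _ _ +] _] _] := ser _ _ FQ' Q'x; apply.
have [P00|[pP P0P]] := PP.
  exfalso; apply: (maxP P0); last by right; split.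
  split; first by rewrite P00.
  rewrite P00 => /(_ ([set 0], [set 0])); apply.
  by apply: (serre_sub (proj1 pP0)) => //; exact: gset_set0.
exists P; split=> // Q sQ PQ nQP; apply: contrapT => nQ.
apply: (maxP Q); first by split.
by right; split=> //; exact: subset_trans PQ.
Qed.

Section SerreTheory.
Context (P : set (set A * set A)) (sP : serre P).

Let Psub := serre_sub sP.
Let Ptrans := serre_trans sP.
Let Pimage := serre_image sP.

Lemma serre_refl phi : gset phi -> P (phi, phi).
Proof. by move=> g; apply: Psub. Qed.

Lemma serre_subl phi psi chi : gset phi -> phi `<=` psi -> P (psi, chi) -> P (phi, chi).
Proof.
move=> g sub Pp; apply: Ptrans (Pp); apply: Psub => //.
by have [] := serre_gset sP Pp.
Qed.

Lemma serre_subr phi psi chi : gset chi -> psi `<=` chi -> P (phi, psi) -> P (phi, chi).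
Proof.
move=> g sub Pp; apply: Ptrans (Pp) _; apply: Psub => //.
by have [] := serre_gset sP Pp.
Qed.

(** Intersecting with a definable subgroup is taking an image, under a restriction
    of the identity. *)
Lemma serreI phi psi chi : P (phi, psi) -> P (phi, chi) -> P (phi, psi `&` chi).
Proof.
move=> Pp Pc; have [gphi gpsi] := serre_gset sP Pp; have [_ gchi] := serre_gset sP Pc.
have H : P (phi, chi `&` phi).
  by have := Pimage (good_restriction gphi) Pc; rewrite !image_restriction setIid.
apply: Ptrans H _.
have := Pimage (good_restriction gchi) Pp; rewrite !image_restriction.
by rewrite setIC.
Qed.

Lemma serre_add phi psi chi : P (phi, chi) -> P (psi, chi) ->
  P (image_of (translation psi) phi, chi).
Proof.
move=> Pp Pc; have [gphi gchi] := serre_gset sP Pp; have [gpsi _] := serre_gset sP Pc.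
apply: Ptrans (Pimage (good_translation gpsi) Pp) _.
have := Pimage (good_translation gchi) Pc.
have -> : image_of (translation chi) psi = image_of (translation psi) chi.
  apply/seteqP; split=> y [x px /translationE yx].
    by exists (y - x) => //; apply/translationE; rewrite opprB addrC subrK.
  by exists (y - x) => //; apply/translationE; rewrite opprB addrC subrK.
apply: serre_subr => // y [x cx /translationE cyx].
by rewrite -[y](subrK x) addrC; apply: gset_add.
Qed.

(** The form in which sums are met below: values of a composite relation split
    into a part that is controlled and up to two indeterminacies. *)
Lemma serre_sum3 phi psi chi omega B : gset omega ->
  (forall z, omega z -> exists x y t, [/\ phi x, psi y, chi t & z = x + y + t]) ->
  P (phi, B) -> P (psi, B) -> P (chi, B) -> P (omega, B).
Proof.
move=> go ho p1 p2 p3; apply: serre_subl (serre_add (serre_add p1 p2) p3) => //.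
move=> _ /ho[x [y [t [px py pt ->]]]]; exists (x + y); last first.
  by apply/translationE; rewrite addrC addKr.
by exists x => //; apply/translationE; rewrite addrC addKr.
Qed.

End SerreTheory.
End Calculus.
End Relations.

(** * Simple subgroups and layers *)

Section Simple.
Context (R : pzRingType) (A : lmodType R) (good : (A -> A -> Prop) -> Prop).
Context (cG : calculus good) (P : set (set A * set A)) (sP : serre good P).
Implicit Types (rho sigma theta : A -> A -> Prop) (phi psi chi : set A).

Local Notation gset := (gset good).

(** A simple object of the category localized at the small subquotients. *)
Definition serre_simple phi := [/\ gset phi, ~ P (phi, [set 0])
  & forall chi, gset chi -> chi `<=` phi -> P (chi, [set 0]) \/ P (phi, chi)].

(** Otherwise one could descend forever; [P0] is the order for which the chain
    condition is known, and it is finer than [P]. *)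
Lemma serre_simple_exists P0 : P0 `<=` P ->
  (forall phi : nat -> set A, (forall n, gset (phi n)) ->
     (forall n, phi n.+1 `<=` phi n) -> exists n, P0 (phi n, phi n.+1)) ->
  ~ P (setT, [set 0]) -> exists phi, serre_simple phi.
Proof.
move=> P0P dcc nT; apply: contrapT => /forallNP nS.
pose T := {phi : set A | gset phi /\ ~ P (phi, [set 0])}.
have /choice[f fP] : forall t : T, exists t' : T, sval t' `<=` sval t /\ ~ P (sval t, sval t').
  move=> [phi [gphi nphi]] /=; have /not_and3P := nS phi.
  have : exists chi, [/\ gset chi, chi `<=` phi, ~ P (chi, [set 0]) & ~ P (phi, chi)].
    apply: contrapT => H; apply: (nS phi); split=> // chi gchi sub.
    have [|n1] := pselect (P (chi, [set 0])); first by left.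
    by right; apply: contrapT => n2; apply: H; exists chi.
  by move=> [chi [gchi sub n1 n2]] _; exists (exist _ chi (conj gchi n1)).
pose t0 : T := exist _ setT (conj (gsetT cG) nT).
pose phi n := sval (iter n f t0).
have [|n|n /P0P] := dcc phi.
- by move=> n; have [] := svalP (iter n f t0).
- by have [] := fP (iter n f t0).
- by have [] := fP (iter n f t0).
Qed.

(** Up to small subquotients, [psi] is contained in an extension of [chi] by a
    quotient of a subgroup of [phi]. *)
Definition layer phi psi chi :=
  exists theta, [/\ good theta, P (psi, image_of theta phi) & P (indeterminacy theta, chi)].

Fixpoint layers phi (n : nat) psi chi : Prop :=
  if n is n'.+1 then exists2 omega, layer phi psi omega & layers phi n' omega chi
  else gset psi /\ psi = chi.

Lemma layers_trans phi n m psi chi omega :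
  layers phi n psi chi -> layers phi m chi omega -> layers phi (n + m) psi omega.
Proof.
elim: n psi => [|n IH] psi /=; first by move=> [_ ->].
by move=> [x px xc] co; exists x => //; exact: IH.
Qed.

Lemma layers_filtration phi n psi chi : layers phi n psi chi ->
  exists gamma : nat -> set A, [/\ gamma 0%N = chi, gamma n = psi
    & forall k, (k < n)%N -> layer phi (gamma k.+1) (gamma k)].
Proof.
elim: n psi => [|n IH] psi /=; first by move=> [_ ->]; exists (fun=> chi).
move=> [omega po /IH[gamma [g0 gn gS]]].
exists (fun k => if k == n.+1 then psi else gamma k); split=> //; first by rewrite eqxx.
move=> k; rewrite ltnS leq_eqVlt => /predU1P[->|kn].
  by rewrite eqxx ltn_eqF // gn.
by rewrite (ltn_eqF (_ : k < n.+1)%N) ?ltnS 1?ltnW // eqSS (ltn_eqF kn); exact: gS.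
Qed.

Lemma layer_gset phi psi chi : layer phi psi chi -> gset psi /\ gset chi.
Proof.
move=> [theta [gt p1 p2]].
by have [? _] := serre_gset sP p1; have [_ ?] := serre_gset sP p2.
Qed.

Lemma layers_gset phi n psi chi : layers phi n psi chi -> gset psi /\ gset chi.
Proof.
elim: n psi => [|n IH] psi /=; first by move=> [? <-].
by move=> [omega /layer_gset[? _] /IH[]].
Qed.

Lemma layer_serre phi psi chi : gset phi -> P (psi, chi) -> layer phi psi chi.
Proof.
move=> gphi Pp; have [gpsi gchi] := serre_gset sP Pp.
exists (fun _ y => chi y); split=> //; last exact: (serre_refl sP gchi).
suff -> : image_of (fun _ y => chi y) phi = chi by [].
apply/seteqP; split=> [y []//|y cy]; exists 0 => //; exact: (gset_0 cG).
Qed.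

(** Images of layers are layers, by composition with [theta]. *)
Lemma layer_serre_order phi : gset phi ->
  serre good [set x | exists n, layers phi n x.1 x.2].
Proof.
move=> gphi; split=> /=.
- by move=> psi chi [n /layers_gset].
- move=> psi chi gpsi gchi sub; exists 1%N, chi => //.
  by apply: layer_serre => //; exact: (serre_sub sP).
- by move=> psi chi omega [n nP] [m mP]; exists (n + m)%N; exact: layers_trans mP.
- move=> rho psi chi gr [n nP]; exists n; elim: n psi nP => [|n IH] psi /=.
    by move=> [gpsi <-]; split=> //; apply: (gset_image cG).
  move=> [omega [theta [gt p1 p2]] /IH lP]; exists (image_of rho omega) => //.
  exists (compose theta rho); split; first exact: (calc_comp cG).
    apply: (serre_subr sP _ _ (serre_image sP gr p1)).
      by apply: (gset_image cG) => //; exact: (calc_comp cG).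
    by move=> z [y [x px xy] yz]; exists x => //; exists y.
  exact: (serre_image sP gr p2).
Qed.

(** The order generated by [P] and the smallness of [phi] is strictly larger than
    [P], so it collapses [A]. *)
Lemma maximal_layers phi :
  (forall Q, serre good Q -> P `<=` Q -> ~ Q `<=` P -> Q (setT, [set 0])) ->
  serre_simple phi -> exists n, layers phi n setT [set 0].
Proof.
move=> maxP [gphi nphi _]; apply: (maxP _ (layer_serre_order gphi)) => /=.
  move=> [psi chi] Pp; exists 1%N, chi; first exact: layer_serre.
  by have [_ ?] := serre_gset sP Pp.
move=> QP; apply: nphi; apply: QP => /=.
exists 1%N, [set 0]; last by split=> //; exact: (gset_set0 cG).
exists (graph 1); split; first exact: (calc_graph cG).
  apply: (serre_sub sP) => //; first by apply: (gset_image cG) => //; exact: (calc_graph cG).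
  by move=> x px; exists x; rewrite // /graph scale1r.
apply: (serre_sub sP); [|exact: (gset_set0 cG)|].
  by apply: (gset_indeterminacy cG); exact: (calc_graph cG).
by move=> x; rewrite /indeterminacy /graph scaler0.
Qed.

End Simple.

(** * Almost maps *)

Section Arrows.
Context (R : pzRingType) (A : lmodType R) (good : (A -> A -> Prop) -> Prop).
Context (cG : calculus good) (P : set (set A * set A)) (sP : serre good P).
Context (phi : set A) (gphi : gset good phi).
Implicit Types (rho sigma tau : A -> A -> Prop) (psi chi gamma : set A).

Local Notation gset := (gset good).

(** Morphisms from [phi] to [A] in the localized category: relations defined on
    almost all of [phi] and almost single-valued. *)
Definition almost_map rho :=
  [/\ good rho, P (phi, domain rho) & P (indeterminacy rho, [set 0])].

(** Two almost maps are equal as morphisms when they share a value at almost every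
    point; for additive relations this controls all the values, since they form
    cosets of small subgroups. *)
Definition agree rho sigma := P (phi, domain (meet rho sigma)).

Definition scaled (a : R) rho := compose rho (graph a).

Let gI := calc_meet cG.
Let gC := calc_comp cG.
Let gV := calc_conv cG.
Let gS := calc_sum cG.
Let gG := calc_graph cG.
Let im := gset_image cG.

Lemma domain_image rho psi chi : gset psi -> good rho ->
  P (psi, domain rho) -> P (image_of rho psi, chi) ->
  P (psi, image_of (converse rho) chi).
Proof.
move=> gpsi gr Pd Pi; apply: (serre_trans sP) (serre_image sP (gV gr) Pi).
apply: (serre_subr sP _ _ (serreI cG sP (serre_refl sP gpsi) Pd)).
  by apply: im; [exact: gV|exact: im].
by move=> x [px [y xy]]; exists y => //; exists x.
Qed.

Lemma agree_refl rho : almost_map rho -> agree rho rho.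
Proof.
move=> [gr Pd _]; apply: (serre_subr sP _ _ Pd).
  by apply: (gset_domain cG); exact: gI.
by move=> x [y xy]; exists y.
Qed.

Lemma agree_sym rho sigma : agree rho sigma -> agree sigma rho.
Proof.
rewrite /agree; suff -> : meet rho sigma = meet sigma rho by [].
by apply/funext => x; apply/funext => y; apply/propext; split=> -[].
Qed.

(** A common value [y] of [rho] and [sigma] and a common value [y'] of [sigma] and
    [tau] differ by an element of the small subgroup [sigma 0], and almost all
    points with that property have [0] as a value of [rho - tau]. *)
Lemma agree_trans rho sigma tau : almost_map rho -> almost_map sigma -> almost_map tau ->
  agree rho sigma -> agree sigma tau -> agree rho tau.
Proof.
move=> [gr _ _] [gs _ Ps] [gt _ _] rs st.
pose kappa := rel_sum rho (scaled (-1) tau).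
have gk : good kappa by apply: gS => //; exact: gC.
apply: (serre_subr sP (psi := image_of (converse kappa) [set 0])).
- by apply: (gset_domain cG); exact: gI.
- move=> x [_ -> [y1 [y2 [xy1 [y xy ->] /esym/eqP]]]].
  rewrite /graph scaleN1r subr_eq0 => /eqP yE.
  by exists y; split=> //; rewrite -yE.
apply: (serre_trans sP) (serre_image sP (gV gk) Ps).
apply: (serre_subr sP _ _ (serreI cG sP rs st)).
  by apply: im; [exact: gV|exact: (gset_indeterminacy cG)].
move=> x [[y [ry sy]] [y' [sy' ty']]]; exists (y - y').
  by have := calc_sub cG gs sy sy'; rewrite subrr.
by exists y, (- y'); split=> //; exists y'; rewrite // /graph scaleN1r.
Qed.

Lemma agree_sub rho sigma : almost_map rho -> almost_map sigma ->
  (forall x y, rho x y -> sigma x y) -> agree rho sigma.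
Proof.
move=> [gr Pd _] [gs _ _] sub; apply: (serre_subr sP _ _ Pd).
  by apply: (gset_domain cG); exact: gI.
by move=> x [y xy]; exists y; split=> //; exact: sub.
Qed.

Lemma almost_map_graph a : almost_map (graph a).
Proof.
split; first exact: gG.
  apply: (serre_sub sP) => //; first exact: (gset_domain cG).
  by move=> x _; exists (a *: x).
apply: (serre_sub sP); [exact: (gset_indeterminacy cG)|exact: (gset_set0 cG)|].
by move=> x; rewrite /indeterminacy /graph scaler0.
Qed.

Lemma almost_map_scaled a rho : almost_map rho -> almost_map (scaled a rho).
Proof.
move=> [gr Pd Pi]; have gs : good (scaled a rho) by exact: gC.
split=> //.
  apply: (serre_subr sP _ _ Pd); first exact: (gset_domain cG).
  by move=> x [y xy]; exists (a *: y), y.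
apply: (serre_trans sP (serre_image sP (gG a) Pi)).
apply: (serre_sub sP); [by apply: im => //; exact: (gset_set0 cG)|exact: (gset_set0 cG)|].
by move=> _ [_ -> ->]; rewrite /= scaler0.
Qed.

Lemma almost_map_sum rho sigma : almost_map rho -> almost_map sigma ->
  almost_map (rel_sum rho sigma).
Proof.
move=> [gr Pd Pi] [gs Pd' Pi']; have g := gS gr gs.
split=> //.
  apply: (serre_subr sP _ _ (serreI cG sP Pd Pd')); first exact: (gset_domain cG).
  by move=> x [[y xy] [z xz]]; exists (y + z), y, z.
apply: (serre_sum3 cG sP _ _ Pi Pi' (serre_refl sP (gset_set0 cG))).
  exact: (gset_indeterminacy cG).
by move=> z [x [y [rx ry ->]]]; exists x, y, 0; rewrite addr0.
Qed.

Lemma agree_scaled a rho sigma : almost_map rho -> almost_map sigma ->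
  agree rho sigma -> agree (scaled a rho) (scaled a sigma).
Proof.
move=> [gr _ _] [gs _ _] rs; apply: (serre_subr sP _ _ rs).
  by apply: (gset_domain cG); apply: gI; exact: gC.
by move=> x [y [ry sy]]; exists (a *: y); split; exists y.
Qed.

Lemma agree_sum rho sigma rho' sigma' :
  almost_map rho -> almost_map sigma -> almost_map rho' -> almost_map sigma' ->
  agree rho rho' -> agree sigma sigma' -> agree (rel_sum rho sigma) (rel_sum rho' sigma').
Proof.
move=> [gr _ _] [gs _ _] [gr' _ _] [gs' _ _] rr ss.
apply: (serre_subr sP _ _ (serreI cG sP rr ss)).
  by apply: (gset_domain cG); apply: gI; exact: gS.
by move=> x [[y [ry ry']] [z [sz sz']]]; exists (y + z); split; exists y, z.
Qed.

Lemma agree_opp rho : almost_map rho -> agree (rel_sum (scaled (-1) rho) rho) (graph 0).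
Proof.
move=> [gr Pd _]; apply: (serre_subr sP _ _ Pd).
  by apply: (gset_domain cG); apply: gI => //; apply: gS => //; exact: gC.
move=> x [y xy]; exists 0; split; last by rewrite /graph scale0r.
exists (- y), y; split; rewrite ?addNr //; exists y; rewrite // /graph scaleN1r //.
Qed.

Lemma agree_image rho sigma gamma : almost_map rho -> almost_map sigma ->
  agree rho sigma -> P (image_of rho phi, gamma) -> P (indeterminacy sigma, gamma) ->
  P (image_of sigma phi, gamma).
Proof.
move=> [gr _ _] [gs _ _] rs Pi Ps.
have Pd := serreI cG sP (serre_refl sP gphi) rs.
have [gd _] := serre_gset sP Pd; have [_ gd'] := serre_gset sP Pd.
apply: (serre_trans sP (serre_image sP gs Pd)).
have [_ gg] := serre_gset sP Pi.
apply: (serre_sum3 cG sP _ _ Pi Ps (serre_sub sP (gset_set0 cG) gg _)).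
- exact: im.
- move=> z [x [px [y [ry sy]]] sz]; exists y, (z - y), 0; split=> //.
  + by exists x.
  + by have := calc_sub cG gs sz sy; rewrite subrr.
  + by rewrite addr0 addrC subrK.
- by move=> _ ->; exact: (gset_0 cG).
Qed.

Lemma agree_zero rho : almost_map rho -> P (image_of rho phi, [set 0]) -> agree rho (graph 0).
Proof.
move=> [gr Pd _] Pi; apply: (serre_subr sP _ _ (domain_image gphi gr Pd Pi)).
  by apply: (gset_domain cG); exact: gI.
by move=> x [_ -> x0]; exists 0; split; rewrite // /graph scale0r.
Qed.

(** Endomorphisms of [phi] in the localized category, which act on almost maps by
    precomposition. *)
Definition almost_endo delta :=
  [/\ good delta, P (phi, image_of (converse delta) phi) & P (indeterminacy delta, [set 0])].

Lemma almost_map_comp delta rho : almost_endo delta -> almost_map rho ->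
  almost_map (compose delta rho).
Proof.
move=> [gd Pd Id] [gr Pr Ir]; have g := gC gd gr; split=> //.
  apply: (serre_subr sP _ _ (serre_trans sP Pd (serre_image sP (gV gd) Pr))).
    exact: (gset_domain cG).
  by move=> x [y [z yz] xy]; exists z, y.
apply: (serre_trans sP) Ir; apply: (serre_trans sP (serre_image sP gr Id)).
apply: (serre_sub sP); [by apply: im => //; exact: (gset_set0 cG)| |].
  exact: (gset_indeterminacy cG).
by move=> y [_ ->].
Qed.

Lemma agree_comp delta rho sigma : almost_endo delta -> almost_map rho ->
  almost_map sigma -> agree rho sigma -> agree (compose delta rho) (compose delta sigma).
Proof.
move=> [gd Pd Id] [gr _ _] [gs _ _] rs.
apply: (serre_subr sP _ _ (serre_trans sP Pd (serre_image sP (gV gd) rs))).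
  by apply: (gset_domain cG); apply: gI; exact: gC.
by move=> x [y [z [rz sz]] xy]; exists z; split; exists y.
Qed.

(** Modulo the small subquotients, [theta phi / theta 0] is a quotient of the
    simple [phi], so it is simple or zero; as [w] maps [phi] to it nontrivially,
    [w] is an isomorphism onto it.  The relation [delta = w^-1 v], taken modulo
    [theta 0], is then an endomorphism of [phi], and [v - w delta] has values in
    [theta 0] up to small subgroups. *)
Lemma layer_dimension v w psi gamma : serre_simple good P phi ->
  almost_map v -> almost_map w -> layer good P phi psi gamma ->
  P (image_of v phi, psi) -> P (image_of w phi, psi) -> ~ P (image_of w phi, gamma) ->
  exists2 delta, almost_endo delta &
    P (image_of (rel_sum v (scaled (-1) (compose delta w))) phi, gamma).
Proof.
move=> [_ _ simp] [gv Pv Iv] [gw Pw Iw] [theta [gt Pt It]] vpsi wpsi nw.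
have [gti gg] := serre_gset sP It.
have zg : P ([set 0], gamma).
  by apply: (serre_sub sP) => //; [exact: (gset_set0 cG)|move=> _ ->; exact: (gset_0 cG)].
pose eta := translation (indeterminacy theta).
have ge : good eta by exact: (good_translation cG).
pose wphi := image_of w phi; have gwphi : gset wphi by exact: im.
have gtphi : gset (image_of theta phi) by exact: im.
have theta_w : P (image_of theta phi, image_of (converse eta) wphi).
  pose chi := phi `&` image_of (converse theta) wphi.
  have gchi : gset chi by apply: (gsetI cG) => //; apply: im => //; exact: gV.
  have [Pc|Pc] := simp chi gchi (@subIsetl _ _ _).
    case: nw; apply: (serre_trans sP) It.
    have Pw' := serreI cG sP (serre_refl sP gwphi) (serre_trans sP wpsi Pt).
    apply: (serre_trans sP Pw').
    apply: (serre_trans sP (psi := image_of theta chi)).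
      apply: (serre_sub sP); [exact: (gsetI cG)|exact: im|].
      by move=> y [wy [u pu uy]]; exists u => //; split=> //; exists y.
    apply: (serre_trans sP (serre_image sP gt Pc)).
    apply: (serre_sub sP) => //; first by apply: im => //; exact: (gset_set0 cG).
    by move=> y [_ ->].
  apply: (serre_subr sP _ _ (serre_image sP gt Pc)); first by apply: im => //; exact: gV.
  move=> y [u [pu [y' wy' uy']] uy]; exists y' => //; apply/translationE.
  by have := calc_sub cG gt uy' uy; rewrite subrr.
pose delta := meet (fun _ x' => phi x') (compose v (compose eta (converse w))).
have gd : good delta by apply: gI => //; apply: gC => //; apply: gC => //; exact: gV.
have ed : almost_endo delta.
  split=> //.
    apply: (serre_subr sP _ _ (domain_image gphi gv Pv
      (serre_trans sP (serre_trans sP vpsi Pt) theta_w))).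
      by apply: im => //; exact: gV.
    move=> x [y [y' [x' px' wy'] yy'] xy]; exists x' => //; split=> //.
    by exists y => //; exists y'.
  have gi := gset_indeterminacy cG gd.
  (* If the kernel [delta 0] were almost all of [phi], the image of [w] would be below [gamma]. *)
  have [//|Pi] := simp _ gi (fun x h => proj1 h).
  case: nw; apply: (serre_trans sP (serre_image sP gw Pi)).
  apply: (serre_sum3 cG sP _ _ (serre_trans sP Iv zg) It (serre_trans sP Iw zg)).
    exact: im.
  move=> z [x' [px' [y vy [y' /translationE yy' wy']]] wz].
  exists y, (y' - y), (z - y'); split=> //.
    by have := calc_sub cG gw wz wy'; rewrite subrr.
  by rewrite subrKC addrC subrK.
exists delta => //.
have [gi _] := serre_gset sP Iv.
apply: (serre_sum3 cG sP _ _ (serre_trans sP Iv zg) It (serre_trans sP Iw zg)).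
  by apply: im => //; apply: gS => //; apply: gC => //; exact: gC.
move=> z [x px [y0 [_ [vy0 [y1 [x' [px' [y vy [y2 /translationE yy2 wy2]]] wy1] ->] ->]]]].
exists (y0 - y), (- (y2 - y)), (y2 - y1); split.
- by have := calc_sub cG gv vy0 vy; rewrite subrr.
- by have := gset_sub cG gti (gset_0 cG gti) yy2; rewrite sub0r.
- by have := calc_sub cG gw wy2 wy1; rewrite subrr.
- by rewrite scaleN1r opprB !subrKA.
Qed.

End Arrows.

(** * The module of almost maps *)

Section ArrowModule.
Local Open Scope quotient_scope.
Context (R : pzRingType) (A : lmodType R) (good : (A -> A -> Prop) -> Prop).
Context (cG : calculus good) (P : set (set A * set A)) (sP : serre good P).
Context (phi : set A) (gphi : gset good phi).

Local Notation AM := (almost_map good P phi).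

Definition arrow : Type := {rho : A -> A -> Prop | AM rho}.
HB.instance Definition _ := gen_eqMixin arrow.
HB.instance Definition _ := gen_choiceMixin arrow.

Definition agreeb : rel arrow := fun rho sigma => `[< agree P phi (sval rho) (sval sigma) >].

Lemma agreeb_equiv : equiv_class_of agreeb.
Proof.
split.
- by move=> rho; apply/asboolP; apply: (agree_refl cG sP); exact: svalP.
- by move=> rho sigma; apply/asboolP/asboolP; exact: agree_sym.
- move=> sigma rho tau /asboolP rs /asboolP st; apply/asboolP.
  by apply: (agree_trans cG sP) rs st; exact: svalP.
Qed.

Canonical agree_equiv := EquivRelPack agreeb_equiv.

(** The proof that [phi] is definable is part of the type because the identity and
    the zero map are almost maps only thanks to it. *)
Definition arrow_module (_ : gset good phi) : Type := {eq_quot agree_equiv}.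
Local Notation HomA := (arrow_module gphi).
HB.instance Definition _ := Choice.copy HomA {eq_quot agree_equiv}.

Definition arrow_class rho (h : AM rho) : HomA := \pi_{eq_quot agree_equiv} (exist _ rho h).

Lemma arrow_class_eq rho sigma (h : AM rho) (h' : AM sigma) : agree P phi rho sigma -> arrow_class h = arrow_class h'.
Proof. by move=> rs; apply/eqquotP/asboolP. Qed.

Lemma arrow_class_agree rho sigma (h : AM rho) (h' : AM sigma) : arrow_class h = arrow_class h' -> agree P phi rho sigma.
Proof. by move=> /eqquotP/asboolP. Qed.

Definition arrow_repr (v : HomA) : A -> A -> Prop := sval (repr v).
Lemma arrow_reprP v : AM (arrow_repr v). Proof. exact: svalP (repr v). Qed.
Lemma arrow_classK v : arrow_class (arrow_reprP v) = v.
Proof.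
rewrite -[RHS]reprK; apply/eqquotP/asboolP.
by apply: (agree_refl cG sP); exact: arrow_reprP.
Qed.

Lemma arrow_ind (Q : HomA -> Prop) : (forall rho (h : AM rho), Q (arrow_class h)) -> forall v, Q v.
Proof. by move=> H v; rewrite -(arrow_classK v). Qed.

Lemma repr_arrow_class rho (h : AM rho) : agree P phi (arrow_repr (arrow_class h)) rho.
Proof. by apply: (arrow_class_agree (arrow_classK (arrow_class h))). Qed.

Definition azero := arrow_class (almost_map_graph cG sP gphi 0).
Definition aadd v w := arrow_class (almost_map_sum cG sP (arrow_reprP v) (arrow_reprP w)).
Definition ascale a v := arrow_class (almost_map_scaled cG sP a (arrow_reprP v)).
Definition aopp v := ascale (-1) v.

Lemma aaddE rho sigma (h : AM rho) (h' : AM sigma) :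
  aadd (arrow_class h) (arrow_class h') = arrow_class (almost_map_sum cG sP h h').
Proof.
apply: arrow_class_eq; apply: (agree_sum cG sP) => //; try exact: arrow_reprP; exact: repr_arrow_class.
Qed.

Lemma ascaleE a rho (h : AM rho) : ascale a (arrow_class h) = arrow_class (almost_map_scaled cG sP a h).
Proof.
apply: arrow_class_eq; apply: (agree_scaled cG sP) => //; try exact: arrow_reprP; exact: repr_arrow_class.
Qed.

Lemma aaddA : associative aadd.
Proof.
elim/arrow_ind => rho h; elim/arrow_ind => sigma h1; elim/arrow_ind => tau h2.
rewrite !aaddE; apply: arrow_class_eq; apply: (agree_sub cG sP);
  try by do ?apply: (almost_map_sum cG sP).
move=> x _ [y [_ [ry [z [t [sz tt ->]]] ->]]].
by exists (y + z), t; split=> //; [exists y, z|rewrite addrA].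
Qed.

Lemma aaddC : commutative aadd.
Proof.
elim/arrow_ind => rho h; elim/arrow_ind => sigma h1.
rewrite !aaddE; apply: arrow_class_eq; apply: (agree_sub cG sP);
  try by do ?apply: (almost_map_sum cG sP).
by move=> x _ [y [z [ry sz ->]]]; exists z, y; rewrite addrC.
Qed.

Lemma aadd0 : left_id azero aadd.
Proof.
elim/arrow_ind => rho h; rewrite aaddE; apply: arrow_class_eq; apply: (agree_sub cG sP) => //.
  by apply: (almost_map_sum cG sP) => //; exact: almost_map_graph.
by move=> x _ [_ [y [-> ry ->]]]; rewrite scale0r add0r.
Qed.

Lemma aaddN : left_inverse azero aopp aadd.
Proof.
elim/arrow_ind => rho h; rewrite /aopp ascaleE aaddE; apply: arrow_class_eq.
exact: (agree_opp cG sP).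
Qed.

HB.instance Definition _ := GRing.isZmodule.Build HomA aaddA aaddC aadd0 aaddN.

Lemma ascaleA a b v : ascale a (ascale b v) = ascale (a * b) v.
Proof.
elim/arrow_ind: v => rho h; rewrite !ascaleE; apply: arrow_class_eq; apply: (agree_sub cG sP);
  try by do ?apply: (almost_map_scaled cG sP).
by move=> x _ [_ [y ry ->] ->]; exists y; rewrite // /graph scalerA.
Qed.

Lemma ascale1 : left_id 1 ascale.
Proof.
elim/arrow_ind => rho h; rewrite !ascaleE; apply: arrow_class_eq; apply: (agree_sub cG sP);
  try by do ?apply: (almost_map_scaled cG sP).
by move=> x _ [y ry ->]; rewrite scale1r.
Qed.

Lemma ascaleDr : right_distributive ascale +%R.
Proof.
move=> a; elim/arrow_ind => rho h; elim/arrow_ind => sigma h1.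
rewrite -[+%R]/aadd !(ascaleE, aaddE); apply: arrow_class_eq; apply: (agree_sub cG sP);
  try by do ?[apply: (almost_map_scaled cG sP)|apply: (almost_map_sum cG sP)].
move=> x _ [_ [y [z [ry sz ->]]] ->]; exists (a *: y), (a *: z).
by rewrite -scalerDr; split=> //; [exists y|exists z].
Qed.

Lemma ascaleDl v : {morph ascale^~ v : a b / a + b}.
Proof.
elim/arrow_ind: v => rho h a b; rewrite -[+%R in RHS]/aadd !(ascaleE, aaddE).
apply: arrow_class_eq; apply: (agree_sub cG sP);
  try by do ?[apply: (almost_map_scaled cG sP)|apply: (almost_map_sum cG sP)].
move=> x _ [y ry ->]; exists (a *: y), (b *: y).
by rewrite /graph scalerDl; split=> //; exists y.
Qed.

HB.instance Definition _ := GRing.Zmodule_isLmodule.Build R HomA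
  ascaleA ascale1 ascaleDr ascaleDl.

Lemma arrow_addE rho sigma (h : AM rho) (h' : AM sigma) :
  arrow_class h + arrow_class h' = arrow_class (almost_map_sum cG sP h h').
Proof. exact: aaddE. Qed.

Lemma arrow_scaleE a rho (h : AM rho) : a *: arrow_class h = arrow_class (almost_map_scaled cG sP a h).
Proof. exact: ascaleE. Qed.

Lemma arrow_oppE rho (h : AM rho) : - arrow_class h = arrow_class (almost_map_scaled cG sP (-1) h).
Proof. exact: ascaleE. Qed.

Definition precompose delta (ed : almost_endo good P phi delta) (v : HomA) :=
  arrow_class (almost_map_comp cG sP ed (arrow_reprP v)).

Lemma precomposeE delta (ed : almost_endo good P phi delta) rho (h : AM rho) :
  precompose ed (arrow_class h) = arrow_class (almost_map_comp cG sP ed h).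
Proof.
apply: arrow_class_eq; apply: (agree_comp cG sP) => //; try exact: arrow_reprP; exact: repr_arrow_class.
Qed.

Lemma precompose_linear delta (ed : almost_endo good P phi delta) : linear (precompose ed).
Proof.
move=> a; elim/arrow_ind => rho h; elim/arrow_ind => sigma h1.
rewrite (arrow_scaleE a h) (arrow_addE _ h1) !precomposeE arrow_scaleE arrow_addE.
apply: arrow_class_eq; apply: (agree_sub cG sP).
- exact: (almost_map_comp cG sP ed (almost_map_sum cG sP (almost_map_scaled cG sP a h) h1)).
- exact: (almost_map_sum cG sP (almost_map_scaled cG sP a (almost_map_comp cG sP ed h))
    (almost_map_comp cG sP ed h1)).
- move=> x _ [y xy [_ [t [[z rz ->] st ->]]]].
  by exists (a *: z), t; split=> //; [exists z => //; exists y|exists y].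
Qed.

(** The inclusion of [phi] in [A] is not the zero morphism. *)
Lemma arrow_nonzero : ~ P (phi, [set 0]) -> exists v : HomA, v != 0.
Proof.
move=> nphi; exists (arrow_class (almost_map_graph cG sP gphi 1)).
apply/eqP => /arrow_class_agree H; apply: nphi; apply: (serre_subr sP (gset_set0 cG) _ H).
by move=> x [y [-> ]]; rewrite /graph scale1r scale0r.
Qed.

(** A chain of [n] layers filters the morphisms by their images.  By
    [layer_dimension], a morphism that is new at some step is carried by an
    endomorphism of [phi] to any other one of that step, modulo the previous one. *)
Lemma arrow_endolength n : serre_simple good P phi ->
  layers good P phi n setT [set 0] -> endolength_at_most HomA n.
Proof.
move=> simp /(layers_filtration)[gamma [g0 gn gS]].
pose U k : set HomA := [set v | P (image_of (arrow_repr v) phi, gamma k)].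
have z_gamma k : (k <= n)%N -> P ([set 0], gamma k).
  move=> kn; have gk : gset good (gamma k).
    case: k kn => [|k] kn; first by rewrite g0; exact: (gset_set0 cG).
    by have [] := layer_gset sP (gS k kn).
  by apply: (serre_sub sP) => //; [exact: (gset_set0 cG)|move=> _ ->; exact: (gset_0 cG)].
have Umk k rho (h : AM rho) : (k <= n)%N -> U k (arrow_class h) <-> P (image_of rho phi, gamma k).
  move=> kn; split=> H.
    apply: (agree_image cG sP gphi (arrow_reprP _) h (repr_arrow_class h) H).
    by have [_ _ I0] := h; apply: (serre_trans sP I0); exact: z_gamma.
  have [_ _ I0] := arrow_reprP (arrow_class h).
  apply: (agree_image cG sP gphi h (arrow_reprP _) _ H).
    exact: agree_sym (repr_arrow_class h).
  by apply: (serre_trans sP I0); exact: z_gamma.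
apply: (@filtration_length _ (endo_module HomA) n U).
- elim/arrow_ind => rho h /(Umk 0%N) H; apply: arrow_class_eq; apply: (agree_zero cG sP) => //.
  by rewrite -g0; exact: H.
- apply/seteqP; split=> // v _; rewrite /U /= gn; have [g _ _] := arrow_reprP v.
  by apply: (serre_sub sP) => //; [exact: (gset_image cG)|exact: (gsetT cG)].
- move=> X k sX kn; elim/arrow_ind => w hw Xw /Umk Uw /Umk nUw.
  elim/arrow_ind => v hv /Umk Uv.
  have nw : ~ P (image_of w phi, gamma k) by move=> H; apply: (nUw (ltnW kn)).
  have [delta ed dP] := layer_dimension cG sP gphi simp hv hw (gS k kn) (Uv kn) (Uw kn) nw.
  have [f fE] := endo_ex (precompose_linear ed).
  exists (endo_fun f (arrow_class hw)); first exact: (submoduleZ f sX Xw).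
  rewrite fE precomposeE.
  have -> : arrow_class hv - arrow_class (almost_map_comp cG sP ed hw) = arrow_class (almost_map_sum cG sP hv
      (almost_map_scaled cG sP (-1) (almost_map_comp cG sP ed hw))).
    by rewrite -arrow_addE -arrow_oppE.
  by apply/Umk => //; exact: ltnW.
Qed.

End ArrowModule.

(** * Relations with convergent witnesses *)

Section Metric.
Context (K : realType) (T : topologicalType) (d : T -> T -> K).
Hypotheses (md : is_metric d) (cd : metric_compatible d).

Lemma metric_cvg (u : nat -> T) (l : T) : u @ \oo --> l ->
  forall e : K, 0 < e -> exists N, forall n, (N <= n)%N -> d l (u n) < e.
Proof.
move=> ul e e0; have : nbhs l [set y | d l y < e] by apply/cd; exists e.
by move=> /ul[N _ NP]; exists N => n Nn; exact: NP.
Qed.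

Lemma metric_cvg_unique (u : nat -> T) (l l' : T) :
  u @ \oo --> l -> u @ \oo --> l' -> l = l'.
Proof.
move=> ul ul'; have [d0 dE dC dT] := md; apply/dE/eqP; rewrite eq_le d0 andbT.
apply/ler_addgt0Pr => e e0; rewrite add0r.
have e20 : 0 < e / 2 by rewrite divr_gt0.
have [N NP] := metric_cvg ul e20; have [N' NP'] := metric_cvg ul' e20.
apply: le_trans (dT l (u (maxn N N')) l') _; rewrite [leRHS]splitr.
apply: lerD; first by apply/ltW/NP; rewrite leq_maxl.
by rewrite dC; apply/ltW/NP'; rewrite leq_maxr.
Qed.

End Metric.

Section Witnessed.
Context (K : realType) (R : pzRingType) (A : topModule R).
Context (d : A -> A -> K) (md : is_metric d) (cd : metric_compatible d).
Context (I : choiceType) (p : I -> A -> A) (lp : forall i, linear (p i)).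

Lemma cvg_add (u v : nat -> A) (a b : A) : u @ \oo --> a -> v @ \oo --> b ->
  (fun n => u n + v n) @ \oo --> a + b.
Proof.
move=> ua vb; apply: (@continuous2_cvg nat A A A \oo _ u v (fun x y => x + y) a b _ ua vb).
exact: (@add_continuous A (a, b)).
Qed.

Lemma cvg_sub (u v : nat -> A) (a b : A) : u @ \oo --> a -> v @ \oo --> b ->
  (fun n => u n - v n) @ \oo --> a - b.
Proof.
move=> ua vb; apply: (@continuous2_cvg nat A A A \oo _ u v (fun x y => x - y) a b _ ua vb).
exact: (@sub_continuous A (a, b)).
Qed.

Lemma cvg_scale (r : R) (u : nat -> A) (a : A) : u @ \oo --> a ->
  (fun n => r *: u n) @ \oo --> r *: a.
Proof.
move=> ua.
apply: (@continuous2_cvg nat (discrete_topology R) A A \oo _ (fun=> r) u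
   (fun s x => s *: x) r a _ _ ua).
  exact: (@topModule_scale_continuous R A (r, a)).
exact: (@cvg_cst (discrete_topology R)).
Qed.

(** Closed subgroups of [A^T], closed in the sense of pointwise limits of sequences
    and stable under the projections of the direct sum. *)
Record family (T : Type) (W : set (T -> A)) : Prop := Family {
  family_0 : W (fun=> 0) ;
  family_sub : forall e f, W e -> W f -> W (fun t => e t - f t) ;
  family_proj : forall i e, W e -> W (fun t => p i (e t)) ;
  family_lim : forall (u : nat -> T -> A) l, (forall n, W (u n)) ->
    (forall t, (fun n => u n t) @ \oo --> l t) -> W l }.

(** Variables of a formula are indexed by [T]; [a] and [b] are the two free ones,
    the others are quantified existentially. *)
Definition witnessed (rho : A -> A -> Prop) : Prop :=
  exists (T : countType) (W : set (T -> A)) (a b : T), family W /\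
  forall x y, rho x y <-> exists2 e, W e & e a = x /\ e b = y.

Let pl i : {linear A -> A} := HB.pack (p i) (GRing.isLinear.Build R A A *:%R (p i) (lp i)).
Let p0 i : p i 0 = 0. Proof. exact: (linear0 (pl i)). Qed.
Let pB i x y : p i (x - y) = p i x - p i y. Proof. exact: (linearB (pl i)). Qed.
Let pD i x y : p i (x + y) = p i x + p i y. Proof. exact: (linearD (pl i)). Qed.
Let pZ i a x : p i (a *: x) = a *: p i x. Proof. exact: (linearZZ (pl i)). Qed.

Lemma family_comp (S T : Type) (f : S -> T) (W : set (S -> A)) :
  family W -> family [set e : T -> A | W (e \o f)].
Proof.
move=> [w0 wB wP wL]; split=> //=.
- by move=> e g; exact: wB.
- by move=> i e; exact: wP.
- by move=> u l Wu ul; apply: (wL (fun n => u n \o f)) => // t; exact: ul.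
Qed.

Lemma family_setI (T : Type) (W W' : set (T -> A)) :
  family W -> family W' -> family (W `&` W').
Proof.
move=> [w0 wB wP wL] [w0' wB' wP' wL']; split=> //=.
- by move=> e g [? ?] [? ?]; split; [exact: wB|exact: wB'].
- by move=> i e [? ?]; split; [exact: wP|exact: wP'].
- move=> u l Wu ul; split; first by apply: (wL u) => // n; have [] := Wu n.
  by apply: (wL' u) => // n; have [] := Wu n.
Qed.

Lemma family_graph (T : Type) (s t : T) (r : R) : family [set e : T -> A | e t = r *: e s].
Proof.
split=> //=; first by rewrite scaler0.
- by move=> e f -> ->; rewrite scalerBr.
- by move=> i e ->; exact: pZ.
- move=> u l Wu ul; apply: (metric_cvg_unique md cd (ul t)).
  have -> : (fun n => u n t) = (fun n => r *: u n s) by apply/funext => n; exact: Wu.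
  exact: cvg_scale.
Qed.

Lemma family_sum (T : Type) (s t r : T) : family [set e : T -> A | e r = e s + e t].
Proof.
split=> //=; first by rewrite addr0.
- by move=> e f -> ->; rewrite opprD addrACA.
- by move=> i e ->; exact: pD.
- move=> u l Wu ul; apply: (metric_cvg_unique md cd (ul r)).
  have -> : (fun n => u n r) = (fun n => u n s + u n t) by apply/funext => n; exact: Wu.
  exact: cvg_add.
Qed.

Lemma family_eq (T : Type) (s t : T) : family [set e : T -> A | e t = e s].
Proof.
have := family_graph s t 1; suff -> : [set e : T -> A | e t = 1 *: e s] = [set e | e t = e s] by [].
by apply/seteqP; split=> e /=; rewrite scale1r.
Qed.

Definition join (S T : Type) (e : S -> A) (f : T -> A) (x : S + T) : A :=
  match x with inl s => e s | inr t => f t end.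

(** The index type of a compound formula is the disjoint union of those of its
    parts, with equations that identify the shared variables. *)
Lemma witnessed_calculus : calculus witnessed.
Proof.
split.
- by move=> rho [T [W [a [b [fW rE]]]]]; apply/rE; exists (fun=> 0) => //; exact: family_0.
- move=> rho [T [W [a [b [fW rE]]]]] x y x' y' /rE[e We [<- <-]] /rE[f Wf [<- <-]].
  by apply/rE; exists (fun t => e t - f t) => //; exact: family_sub.
- exists bool, setT, true, false; split; first by split.
  by move=> x y; split=> // _; exists (fun c : bool => if c then x else y).
- move=> r; exists bool, [set e : _ -> A | e false = r *: e true], true, false.
  split; first exact: family_graph.
  move=> x y; split=> [xy|[e /= eE [<- <-]]//].
  by exists (fun c : bool => if c then x else y).
- move=> rho [T [W [a [b [fW rE]]]]]; exists T, W, b, a; split=> // x y.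
  by split=> [/rE[e We [? ?]]|[e We [? ?]]]; [exists e|apply/rE; exists e].
- move=> rho sigma [T1 [W1 [a1 [b1 [f1 r1]]]]] [T2 [W2 [a2 [b2 [f2 r2]]]]].
  exists (T1 + T2)%type, ([set e : _ -> A | W1 (e \o inl)] `&` [set e : _ -> A | W2 (e \o inr)] `&`
      [set e : _ -> A | e (inl b1) = e (inr a2)]), (inl a1), (inr b2).
  split; first by do !apply: family_setI; [exact: family_comp|exact: family_comp|exact: family_eq].
  move=> x z; split.
    move=> [y /r1[e We [<- ey]] /r2[f Wf [fy <-]]].
    by exists (join e f) => //=; split=> //=; rewrite ey fy.
  move=> [e [[W1e W2e] eE] [<- <-]]; exists (e (inl b1)).
    by apply/r1; exists (e \o inl).
  by rewrite eE; apply/r2; exists (e \o inr).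
- move=> rho sigma [T1 [W1 [a1 [b1 [f1 r1]]]]] [T2 [W2 [a2 [b2 [f2 r2]]]]].
  exists (T1 + T2)%type, ([set e : _ -> A | W1 (e \o inl)] `&` [set e : _ -> A | W2 (e \o inr)] `&`
      ([set e : _ -> A | e (inl a1) = e (inr a2)] `&` [set e : _ -> A | e (inl b1) = e (inr b2)])), (inl a1), (inl b1).
  split.
    apply: family_setI; apply: family_setI;
      [exact: family_comp|exact: family_comp|exact: family_eq|exact: family_eq].
  move=> x y; split.
    move=> [/r1[e We [ex ey]] /r2[f Wf [fx fy]]].
    by exists (join e f) => //=; do 2?split=> //=; rewrite ?ex ?fx ?ey ?fy.
  move=> [e [[W1e W2e] [ex ey]] [xE yE]]; split.
    by apply/r1; exists (e \o inl).
  by apply/r2; exists (e \o inr) => //=; rewrite -ex -ey.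
- move=> rho sigma [T1 [W1 [a1 [b1 [f1 r1]]]]] [T2 [W2 [a2 [b2 [f2 r2]]]]].
  pose i1 x : option (T1 + T2) := Some (inl x); pose i2 x : option (T1 + T2) := Some (inr x).
  exists (option (T1 + T2)), ([set e : _ -> A | W1 (e \o i1)] `&` [set e : _ -> A | W2 (e \o i2)] `&`
      ([set e : _ -> A | e (i1 a1) = e (i2 a2)] `&` [set e : _ -> A | e None = e (i1 b1) + e (i2 b2)])), (i1 a1), None.
  split.
    apply: family_setI; apply: family_setI;
      [exact: family_comp|exact: family_comp|exact: family_eq|exact: family_sum].
  move=> x y; split.
    move=> [y1 [y2 [/r1[e We [ex ey]] /r2[f Wf [fx fy]] ->]]].
    exists (fun t => if t is Some t' then join e f t' else y1 + y2) => //=.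
    by do 2?split=> //=; rewrite ?ex ?fx ?ey ?fy.
  move=> [e [[W1e W2e] [ex ey]] [xE yE]].
  exists (e (i1 b1)), (e (i2 b2)); split; last by rewrite -yE.
    by apply/r1; exists (e \o i1).
  by apply/r2; exists (e \o i2) => //=; rewrite -ex.
Qed.

Lemma witnessed_proj rho i x y : witnessed rho -> rho x y -> rho (p i x) (p i y).
Proof.
move=> [T [W [a [b [fW rE]]]]] /rE[e We [<- <-]]; apply/rE.
by exists (fun t => p i (e t)) => //; exact: family_proj.
Qed.

(** Encoding variables by natural numbers gives all formulas the same index type. *)
Lemma gset_witness phi : gset witnessed phi -> exists (W : set (nat -> A)) (b : nat),
  family W /\ forall y, phi y <-> exists2 e, W e & e b = y.
Proof.
move=> [T [W [a [b [fW rE]]]]]; exists [set e : _ -> A | W (e \o pickle)], (pickle b).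
split; first exact: family_comp.
move=> y; split=> [/(rE 0)[e We [_ <-]]|[e We <-]].
  exists (fun n => if unpickle n is Some t then e t else 0); last by rewrite pickleK.
  rewrite /= (_ : _ \o pickle = e) //.
  by apply/funext => t /=; rewrite pickleK.
by apply/(rE (e (pickle a))); exists (e \o pickle).
Qed.

End Witnessed.

(** * Countability *)

Lemma countable_setU (T : Type) (X Y : set T) : countable X -> countable Y -> countable (X `|` Y).
Proof.
move=> cX cY.
suff -> : X `|` Y = \bigcup_(b in [set: bool]) (if b then X else Y).
  by apply: bigcup_countable => [|[] _]; [exact: countableP| |].
by apply/seteqP; split=> [x [Xx|Yx]|x [[] _ ?]]; [exists true|exists false|left|right].
Qed.

Lemma countable_subset (T : Type) (X Y : set T) : X `<=` Y -> countable Y -> countable X.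
Proof. by move=> XY; apply: sub_countable; exact: subset_card_le. Qed.

Lemma collision (T : choiceType) (C : countType) (X : set T) (f : T -> C) : ~ countable X ->
  exists i j, [/\ X i, X j, i <> j & f i = f j].
Proof.
move=> nX; apply: contrapT => nij; apply: nX; apply/countable_injP.
exists (pickle \o f) => i j; rewrite !inE => Xi Xj /= /(pcan_inj pickleK) fij.
by apply: contrapT => ij; apply: nij; exists i, j.
Qed.

Lemma countable_range (T : Type) (C : countType) (f : C -> T) (X : set T) :
  X `<=` range f -> countable X.
Proof.
move=> Xf; apply: countable_subset Xf _.
by apply: sub_countable (card_image_le _ _) _; exact: countableP.
Qed.

Lemma countable_enum (T : choiceType) (x0 : T) (X : set T) : countable X ->
  exists e : nat -> T, X `<=` range e.
Proof.
move=> /countable_injP[f fI].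
exists (fun n => xget x0 [set x | X x /\ f x = n]) => x Xx; exists (f x) => //.
case: xgetP => [y _ [Xy yx]|/(_ x)]; last by case.
by apply: fI => //; rewrite inE.
Qed.

(** * Descending chains in Polish modules *)

Section Small.
Context (K : realType) (R : pzRingType) (A : topModule R).

Lemma nbhs_seqI (X : eqType) (l : seq X) (B : X -> set A) :
  (forall x, x \in l -> nbhs (0 : A) (B x)) ->
  exists2 V, nbhs (0 : A) V & forall x, x \in l -> V `<=` B x.
Proof.
elim: l => [|x l IH] nB; first by exists setT => //; exact: filterT.
have [|V nV VB] := IH; first by move=> y yl; apply: nB; rewrite inE yl orbT.
exists (B x `&` V); first by apply: filterI => //; apply: nB; rewrite inE eqxx.
move=> y; rewrite inE => /predU1P[->|yl] a [Ba Va] //; exact: VB.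
Qed.

Lemma nbhs_sub_split (V : set A) : nbhs (0 : A) V ->
  exists2 W, nbhs (0 : A) W & forall a b, W a -> W b -> V (a - b).
Proof.
move=> nV; have := @sub_continuous A ((0 : A), (0 : A)).
rewrite /continuous_at /= subr0 => /(_ V nV) [[B C] /= [nB nC] BC].
exists (B `&` C); first exact: filterI.
by move=> a b [Ba _] [_ Cb]; exact: (BC (a, b)).
Qed.

Lemma nbhs_translate (x : A) (U : set A) : nbhs x U -> nbhs (0 : A) [set a | U (x + a)].
Proof.
move=> nU; have := @add_continuous A (x, (0 : A)).
rewrite /continuous_at /= addr0 => /(_ U nU) [[B C] /= [nB nC] BC].
by apply: filterS nC => a Ca; apply: (BC (x, a)); split=> //; exact: nbhs_singleton.
Qed.

(** [tau] sorts the points of [A] into countably many boxes of size [V]. *)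
Lemma dense_approx (t : nat -> A) (V : set A) : dense (range t) -> nbhs (0 : A) V ->
  exists tau : A -> nat, forall a, V (a - t (tau a)).
Proof.
move=> dt nV; suff /choice[tau tauP] : forall a, exists n, V (a - t n) by exists tau.
move=> a; have nU : nbhs a [set b | V (a - b)].
  have := @sub_continuous A (a, a); rewrite /continuous_at /= subrr => /(_ V nV).
  move=> [[B C] /= [nB nC] BC]; apply: filterS nC => b Cb; apply: (BC (a, b)).
  by split=> //; exact: nbhs_singleton.
move: nU; rewrite nbhsE => -[O [oO Oa] OU].
have [|b [Ob [n _ nb]]] := dt O _ oO; first by exists a.
by exists n; rewrite nb; exact: OU.
Qed.

End Small.

Section Descent.
Context (K : realType) (R : pzRingType) (A : topModule R).
Context (d : A -> A -> K) (md : is_metric d) (cd : metric_compatible d).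
Context (dcomplete : metric_complete d).
Context (t : nat -> A) (dense_t : dense (range t)).
Context (I : choiceType) (U : I -> set A).
Context (p : I -> A -> A) (prj : projections U p).

Let lp : forall i, linear (p i). Proof. by case: prj. Qed.
Let pl i : {linear A -> A} := HB.pack (p i) (GRing.isLinear.Build R A A *:%R (p i) (lp i)).
Let p0 i : p i 0 = 0. Proof. exact: (linear0 (pl i)). Qed.
Let pB i x y : p i (x - y) = p i x - p i y. Proof. exact: (linearB (pl i)). Qed.
Let pD i x y : p i (x + y) = p i x + p i y. Proof. exact: (linearD (pl i)). Qed.

Context (phi : nat -> set A) (W : nat -> set (nat -> A)) (b : nat -> nat).
Hypothesis fW : forall n, family p (W n).
Hypothesis phiE : forall n y, phi n y <-> exists2 e, W n e & e (b n) = y.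
Hypothesis phi_dec : forall n, phi n.+1 `<=` phi n.
Hypothesis phi_big : forall n, ~ countable [set i | ~ (phi n `&` U i `<=` phi n.+1)].

Lemma phi_le m n : (n <= m)%N -> phi m `<=` phi n.
Proof.
move=> nm; rewrite -(subnKC nm); elim: (m - n)%N => [|k IH]; first by rewrite addn0.
by rewrite addnS; apply: subset_trans IH; exact: phi_dec.
Qed.

(** Data of one step: [x] is the difference of two elements [y] and [z] of unused
    summands [U i] and [U j], [e n] is a witness of [phi n x] for each [n <= m], and
    adding the first coordinates of [e n] to those of [s n] moves them by less than
    [eps]. *)
Definition stage_ok (m : nat) (s : nat -> nat -> A) (used : seq I) (eps : K)
    (o : (I * I) * (A * A) * (nat -> nat -> A)) : Prop :=
  let: ((i, j), (y, x), e) := o in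
  [/\ i \notin used /\ j \notin used, U i y /\ (exists2 z, U j z & x = y - z) /\ i <> j,
      ~ phi m.+1 y,
      forall n, (n <= m)%N -> W n (e n) /\ e n (b n) = x
    & forall n v, (n <= m)%N -> (v <= m)%N -> d (s n v) (s n v + e n v) < eps].

(** Uncountably many summands contain an element [y_i] of [phi m] outside
    [phi m.+1].  By separability two of them have witnesses that agree up to a small
    error in the finitely many coordinates under control. *)
Lemma stage m s used eps : 0 < eps -> exists o, stage_ok m s used eps o.
Proof.
move=> eps0.
pose l := [seq (n, v) | n <- iota 0 m.+1, v <- iota 0 m.+1].
have lP n v : (n <= m)%N -> (v <= m)%N -> (n, v) \in l.
  by move=> nm vm; apply: allpairs_f; rewrite mem_iota add0n ltnS.
have [|V nV VP] := @nbhs_seqI R A _ l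
    (fun nv => [set a | d (s nv.1 nv.2) (s nv.1 nv.2 + a) < eps]).
  move=> [n v] _ /=; apply: (nbhs_translate (U := [set a | d (s n v) a < eps])).
  by apply/cd; exists eps.
have [V' nV' V'P] := nbhs_sub_split nV.
have [tau tauP] := dense_approx dense_t nV'.
pose J := [set i | ~ (phi m `&` U i `<=` phi m.+1)] `\` [set` used].
have nJ : ~ countable J.
  move=> cJ; apply: (@phi_big m).
  apply: countable_subset _ (countable_setU cJ (finite_set_countable (finite_seq used))).
  move=> i iJ; have [iu|iu] := boolP (i \in used); [by right|left].
  by split=> //; apply/negP.
have /choice[o oP] : forall i, exists o : A * (nat -> nat -> A), J i ->
    [/\ U i o.1, ~ phi m.+1 o.1 & forall n, (n <= m)%N -> W n (o.2 n) /\ o.2 n (b n) = o.1].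
  move=> i; have [Ji|] := pselect (J i); last by exists (0, fun=> fun=> 0).
  have [y [[py Uy] ny]] : exists y, (phi m `&` U i) y /\ ~ phi m.+1 y.
    by case: Ji => /existsNP[y /not_implyP[? ?]] _; exists y.
  have /choice[e eP] : forall n, exists e, (n <= m)%N -> W n e /\ e (b n) = y.
    move=> n; have [nm|] := leqP n m; last by exists (fun=> 0).
    by have /phiE[e We eb] := phi_le nm py; exists e.
  by exists (y, e).
(* Two indices with the same code have witnesses in the same boxes. *)
pose code i := [seq tau ((o i).2 nv.1 nv.2) | nv <- l].
have [i [j [Ji Jj ij cij]]] := collision code nJ.
have [Ui ni Wi] := oP i Ji; have [Uj nj Wj] := oP j Jj.
exists ((i, j), ((o i).1, (o i).1 - (o j).1), fun n v => (o i).2 n v - (o j).2 n v).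
split=> //.
- by split; apply/negP; [case: Ji|case: Jj].
- by split=> //; split=> //; exists (o j).1.
- move=> n nm; have [Win <-] := Wi n nm; have [Wjn <-] := Wj n nm; split=> //.
  exact: (family_sub (fW n)).
- move=> n v nm vm; apply: (VP _ (lP n v nm vm)).
  have tij : tau ((o i).2 n v) = tau ((o j).2 n v).
    by have /eq_in_map/(_ _ (lP n v nm vm)) := cij.
  set x := (o i).2 n v; set y := (o j).2 n v.
  have -> : x - y = (x - t (tau x)) - (y - t (tau y)).
    by rewrite tij opprB subrKA.
  exact: V'P.
Qed.

(** The distances from step [m] on add up to at most twice [2^-m]. *)
Lemma geometric_cauchy (u : nat -> A) (N : nat) :
  (forall m, (N <= m)%N -> d (u m) (u m.+1) < 2^-1 ^+ m) -> exists l : A, u @ \oo --> l.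
Proof.
move=> uS; have [d0 dE dC dT] := md; apply: dcomplete => eps eps0.
have h0' m : (0 : K) < 2^-1 ^+ m by rewrite exprn_gt0 // invr_gt0.
have h m : 2^-1 ^+ m = 2 * (2^-1 ^+ m - 2^-1 ^+ m.+1) :> K.
  by rewrite exprS; lra.
have bound m k : (N <= m)%N -> d (u m) (u (m + k)%N) <= 2 * (2^-1 ^+ m - 2^-1 ^+ (m + k)).
  move=> Nm; elim: k => [|k IH].
    by rewrite addn0 subrr mulr0 (proj2 (dE _ _) erefl).
  apply: le_trans (dT _ (u (m + k)%N) _) _.
  rewrite addnS (_ : 2 * _ = 2 * (2^-1 ^+ m - 2^-1 ^+ (m + k)) + 2^-1 ^+ (m + k)).
    by apply: lerD => //; apply/ltW/uS; exact: leq_trans (leq_addr _ _).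
  by have := h (m + k)%N; lra.
pose M := Num.bound (4 / eps).
exists (maxn N M) => m n Nm Nn.
have dN k : (maxn N M <= k)%N -> d (u (maxn N M)) (u k) < eps / 2.
  move=> Nk; rewrite -(subnKC Nk).
  apply: le_lt_trans (bound _ _ (leq_maxl _ _)) _.
  apply: (@le_lt_trans _ _ (2 * 2^-1 ^+ maxn N M)).
    by have := h0' (maxn N M + (k - maxn N M))%N; lra.
  have : 4 / eps < 2 ^+ maxn N M by apply: upper_nthrootP; exact: leq_maxr.
  rewrite exprVn ltr_pdivrMr // => H.
  have P0 : (0 : K) < 2 ^+ maxn N M by exact: exprn_gt0.
  by rewrite ltr_pdivrMr // mulrAC ltr_pdivlMr //; lra.
apply: le_lt_trans (dT _ (u (maxn N M)) _) _.
by rewrite [ltRHS]splitr dC ltrD // dN.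
Qed.

(** Choose differences [x m] in [phi m] by [stage], at new summands [U (i m)] and
    [U (j m)] each time.  For each [n] the witnesses of the [phi n x m], [m >= n],
    have a convergent sum: the coordinate [v] is under control from step
    [max n v] on.  Since the family [W n] is closed, the sum [a] of all the [x m]
    satisfies [phi n (a - X n)], where [X n] is the [n]-th partial sum.  Projecting
    to [U (i m)] modulo [phi m.+1], [a] becomes [y m], which is not in
    [phi m.+1].  So [a] has a nonzero component in each of infinitely many
    summands. *)
Lemma descent : False.
Proof.
have h0 m : (0 : K) < 2^-1 ^+ m by rewrite exprn_gt0 // invr_gt0.
have /choice[F FP] : forall q : nat * (nat -> nat -> A) * seq I,
    exists o, stage_ok q.1.1 q.1.2 q.2 (2^-1 ^+ q.1.1) o.
  by move=> q; exact: stage.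
pose next m (st : (nat -> nat -> A) * seq I) : (nat -> nat -> A) * seq I :=
  let o := F (m, st.1, st.2) in
  (fun n v => st.1 n v + (if (n <= m)%N then o.2 n v else 0),
   o.1.1.1 :: o.1.1.2 :: st.2).
pose St := fix St m := if m is m'.+1 then next m' (St m') else ((fun _ _ => 0), [::]).
pose S m := (St m).1; pose used m := (St m).2.
pose o m := F (m, S m, used m).
pose i m := (o m).1.1.1; pose j m := (o m).1.1.2.
pose y m := (o m).1.2.1; pose x m := (o m).1.2.2; pose e m := (o m).2.
have okE m : [/\ i m \notin used m /\ j m \notin used m,
    U (i m) (y m) /\ (exists2 z, U (j m) z & x m = y m - z) /\ i m <> j m,
    ~ phi m.+1 (y m),
    forall n, (n <= m)%N -> W n (e m n) /\ e m n (b n) = x m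
  & forall n v, (n <= m)%N -> (v <= m)%N -> d (S m n v) (S m n v + e m n v) < 2^-1 ^+ m].
  have := FP (m, S m, used m); rewrite -/(o m) /= /i /j /y /x /e.
  by case: (o m) => [[[? ?] [? ?]] ?].
have SE m n v : S m.+1 n v = S m n v + (if (n <= m)%N then e m n v else 0) by [].
have S0 n v m : (m <= n)%N -> S m n v = 0.
  elim: m => [//|m IH] mn; rewrite SE IH ?(ltnW mn) // leqNgt mn addr0 //.
have usedP k m : (k < m)%N -> i k \in used m /\ j k \in used m.
  elim: m => [//|m IH]; rewrite ltnS leq_eqVlt.
  have -> : used m.+1 = i m :: j m :: used m by [].
  move=> /predU1P[->|/IH[ik jk]]; first by rewrite !inE !eqxx orbT.
  by rewrite !inE ik jk !orbT.
have WS n m : W n (S m n).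
  elim: m => [|m IH]; first exact: (family_0 (fW n)).
  have [mn|nm] := leqP n m; last first.
    suff -> : S m.+1 n = S m n by [].
    by apply/funext => v; rewrite SE leqNgt nm addr0.
  have [_ _ _ /(_ n mn)[We _] _] := okE m.
  have -> : S m.+1 n = fun v => S m n v - (0 - e m n v).
    by apply/funext => v; rewrite SE mn sub0r opprK.
  apply: (family_sub (fW n) IH).
  by apply: (family_sub (fW n) _ We); exact: (family_0 (fW n)).
pose X m := S m 0%N (b 0%N).
have XS m : X m.+1 = X m + x m.
  by rewrite /X SE; have [_ _ _ /(_ 0%N (leq0n m))[_ ->] _] := okE m.
have SX n m : (n <= m)%N -> S m n (b n) = X m - X n.
  move=> nm; rewrite -(subnKC nm); elim: (m - n)%N => [|k IH].
    by rewrite addn0 subrr S0.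
  rewrite addnS SE leq_addr XS IH.
  by have [_ _ _ /(_ n (leq_addr k n))[_ ->] _] := okE (n + k)%N; rewrite addrAC.
have /choice[L LP] : forall nv : nat * nat, exists l : A, (fun m => S m nv.1 nv.2) @ \oo --> l.
  move=> [n v] /=; apply: (@geometric_cauchy _ (maxn n v)) => m.
  rewrite geq_max => /andP[nm vm]; rewrite SE nm.
  by have [_ _ _ _] := okE m; apply.
have WL n : W n (fun v => L (n, v)).
  by apply: (family_lim (fW n) (u := fun m => S m n)) => // v; exact: (LP (n, v)).
pose a := L (0%N, b 0%N).
have Xa : X @ \oo --> a by exact: (LP (0%N, b 0%N)).
have tail n : phi n (a - X n).
  apply/phiE; exists (fun v => L (n, v)) => //.
  apply: (metric_cvg_unique md cd (LP (n, b n))) => /=.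
  apply: cvg_trans (near_eq_cvg _) (cvg_sub Xa (@cvg_cst A (X n) nat \oo _)).
  by exists n => // m /= nm; rewrite SX.
have pX m n : (n <= m)%N -> p (i m) (X n) = 0.
  have [_ _ _ _ pU] := prj.
  elim: n => [|n IH] nm; first by rewrite /X.
  rewrite XS pD IH ?(ltnW nm) // add0r.
  have [_ [Uy [[z Uz ->] _]] _ _ _] := okE n.
  have [[im _] _ _ _ _] := okE m; have [inm jnm] := usedP n m nm.
  rewrite pB (pU _ _ _ Uy) (pU _ _ _ Uz).
  by rewrite !ifN ?subr0 //; [apply: contraNneq im => ->|apply: contraNneq im => ->].
have pXS m : p (i m) (X m.+1) = y m.
  have [_ _ _ _ pU] := prj.
  rewrite XS pD pX // add0r; have [_ [Uy [[z Uz ->] ij]] _ _ _] := okE m.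
  rewrite pB (pU _ _ _ Uy) (pU _ _ _ Uz) eqxx ifN ?subr0 //.
  exact/eqP.
have pa m : p (i m) a != 0.
  apply/eqP => pa0; have [_ _ ny _ _] := okE m; apply: ny.
  have := tail m.+1 => /phiE[f Wf fE].
  apply/phiE; exists (fun v => 0 - p (i m) (f v)).
    by apply: (family_sub (fW _)); [exact: (family_0 (fW _))|exact: (family_proj (fW _))].
  by rewrite /= fE pB pa0 pXS sub0r sub0r opprK.
have [_ _ fin_p _ _] := prj.
have [s [us sP]] := finite_support_seq (fin_p a).
have iI : injective i.
  suff H k m : (k < m)%N -> i k <> i m.
    move=> k m ikm; case: (ltngtP k m) => // km.
      by case: (H _ _ km).
    by case: (H _ _ km).
  by move=> km ikm; have [ik _] := usedP k m km; have [[/negP + _] _ _ _ _] := okE m;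
    rewrite -ikm.
have : (size [seq i m | m <- iota 0 (size s).+1] <= size s)%N.
  apply: uniq_leq_size; first by rewrite map_inj_uniq // iota_uniq.
  by move=> _ /mapP[m _ ->]; apply: sP.
by rewrite size_map size_iota ltnn.
Qed.

End Descent.

(** * From Polish modules to endofinite modules *)

Section Kaplansky.
Context (K : realType) (R : pzRingType) (A : topModule R).
Context (I : choiceType) (U : I -> set A).
Hypothesis polA : polish K A.
Hypothesis uncA : ~ countable [set: A].
Hypothesis kapU : kaplansky_decomposition U.

(** Finite sums of elements of a countable set form a countable set. *)
Lemma kaplansky_index_uncountable : ~ countable [set: I].
Proof.
move=> cI; apply: uncA; have [Uok dU] := kapU.
have sU i : submodule (U i) by have [] := Uok i.
have [p [_ Up fp pS _]] := direct_sum_projections sU dU.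
have cU : countable (\bigcup_(i in [set: I]) U i).
  by apply: bigcup_countable => // i _; have [] := Uok i.
have [e eU] := countable_enum (0 : A) cU.
apply: (@countable_range _ (seq nat) (fun s => \sum_(k <- s) e k)) => x _.
have [s [us sP]] := finite_support_seq (fp x).
have /choice[k kP] : forall i, exists n, e n = p i x.
  by move=> i; have [|n _ <-] := eU (p i x); [exists i|exists n].
exists [seq k i | i <- s] => //.
rewrite big_map [RHS](pS x) (fsum_seq us sP).
by apply: eq_bigr => i _; exact: kP.
Qed.

Lemma polish_kaplansky_endofinite : has_endofinite R.
Proof.
have [[D cD dD] [d [md cd compl]]] := polA.
have [Uok dU] := kapU.
have sU i : submodule (U i) by have [] := Uok i.
have [p prj] := direct_sum_projections sU dU.
have [lp Up _ _ pU] := prj.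
have [t tD] := countable_enum (0 : A) cD.
have dt : dense (range t).
  by move=> O O0 oO; have [x [Ox /tD tx]] := dD O O0 oO; exists x.
pose good := witnessed p; have cG : calculus good := witnessed_calculus md cd lp.
pose excess (phi psi : set A) := [set i | ~ (phi `&` U i `<=` psi)].
pose P0 := [set x : set A * set A | [/\ gset good x.1, gset good x.2 & countable (excess x.1 x.2)]].
have pP0 : proper_serre good P0.
  split; last first.
    move=> [_ _ /= c]; apply: kaplansky_index_uncountable.
    apply: countable_subset c => i _ /= H; have [_ /eqP + _] := Uok i; apply.
    apply/seteqP; split=> [x Ux|_ ->]; first exact: H.
    exact: submodule0.
  split.
  - by move=> phi psi [].
  - move=> phi psi gphi gpsi sub; split=> //=.
    apply: countable_subset (@countable0 I) => i [] x [/sub //].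
  - move=> phi psi chi [g1 g2 /= c1] [_ g3 /= c2]; split=> //=.
    apply: countable_subset (countable_setU c1 c2) => i /=; apply: contra_notP.
    move=> /not_orP[/contrapT s1 /contrapT s2] x [px Ux].
    by apply: s2; split=> //; apply: s1.
  - move=> rho phi psi gr [g1 g2 /= c]; split=> /=; try exact: (gset_image cG).
    apply: countable_subset c => i /=; apply: contra_not => s y [[x px xy] Uy].
    exists (p i x); last first.
      by have := witnessed_proj i gr xy; rewrite (pU i i y Uy) eqxx.
    by apply: s; split=> //; exact: (witnessed_proj i g1 (x := 0) px).
have [P [[sP nP] P0P maxP]] := maximal_serre cG pP0.
have [|phi simp] := serre_simple_exists cG P0P _ nP.
  move=> phi gphi dec; apply: contrapT => /forallNP nn.
  have /choice[Wb WbP] : forall n, exists Wb : set (nat -> A) * nat,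
      family p Wb.1 /\ forall y, phi n y <-> exists2 e, Wb.1 e & e Wb.2 = y.
    by move=> n; have [W [b ?]] := gset_witness (gphi n); exists (W, b).
  apply: (descent md cd compl dt prj (W := fun n => (Wb n).1)
    (b := fun n => (Wb n).2) _ _ dec).
  - by move=> n; have [] := WbP n.
  - by move=> n; have [] := WbP n.
  - by move=> n c; apply: (nn n); split=> /=; [exact: gphi|exact: gphi|exact: c].
have [gphi nphi _] := simp.
have [n nL] := maximal_layers cG sP maxP simp.
exists (arrow_module cG sP gphi); split; first exact: arrow_nonzero.
by exists n; exact: arrow_endolength.
Qed.

End Kaplansky.

(** * Countable division subrings *)

Definition subring_type (D : pzRingType) (C : set D)
  (hC : subring_closed [in C]) : Type := {x : D | x \in [in C]}.

Section SubringType.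
Context (D : pzRingType) (C : set D) (hC : subring_closed [in C]).
HB.instance Definition _ := SubChoice.copy (subring_type hC) {x : D | x \in [in C]}.
HB.instance Definition _ :=
  GRing.SubChoice_isSubPzRing.Build D _ (subring_type hC) hC.
End SubringType.

(** Terms over the generators [e]; being a countable type, they have a countable
    set of values.  Differences and the default value [1] provide [0] and sums. *)
Fixpoint ring_term (D : pzRingType) (inv : D -> D) (e : nat -> D)
    (t : GenTree.tree nat) : D :=
  match t with
  | GenTree.Leaf k => e k
  | GenTree.Node 0 [:: a; b] => ring_term inv e a - ring_term inv e b
  | GenTree.Node 1 [:: a; b] => ring_term inv e a * ring_term inv e b
  | GenTree.Node _ [:: a] => inv (ring_term inv e a)
  | _ => 1
  end.

Lemma countable_division_subring (R D : pzRingType) n (rho : matrix_rep R D n) :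
  countable [set: R] -> division_ring D ->
  exists D0 : pzRingType, [/\ division_ring D0, countable [set: D0]
    & inhabited (matrix_rep R D0 n)].
Proof.
move=> cR [D1 dD].
have [eR eRT] := countable_enum (0 : R) cR.
have /choice[inv invP] : forall x : D, exists y, x != 0 -> y * x = 1.
  by move=> x; have [->|/dD[y yx]] := eqVneq x 0; [exists 0|exists y].
have [e eE] : exists e : nat -> D, forall a i j, exists k, e k = rho a i j.
  pose f (x : nat * 'I_n * 'I_n) := rho (eR x.1.1) x.1.2 x.2.
  have [e eP] := countable_enum (0 : D) (@countable_range _ _ f (range f) (fun _ => id)).
  exists e => a i j; have [k _ ak] := eRT a I.
  by have [|m _ <-] := eP (rho a i j); [exists (k, i, j); rewrite /f //= ak|exists m].
pose ev := ring_term inv e; pose C := range ev.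
have hC : subring_closed [in C].
  split; first by rewrite inE; exists (GenTree.Node 0 [::]).
    move=> x y; rewrite !inE => -[s _ <-] [t _ <-].
    by exists (GenTree.Node 0 [:: s; t]).
  move=> x y; rewrite !inE => -[s _ <-] [t _ <-].
  by exists (GenTree.Node 1 [:: s; t]).
pose D0 : pzRingType := subring_type hC.
have exD0 x : C x -> exists y : D0, val y = x.
  move=> Cx; have Cx' : x \in [in C] by rewrite inE.
  by exists (exist _ x Cx').
have D0C (x : D0) : C (val x) by have := valP x; rewrite inE.
exists D0; split.
- split=> [|x x0]; first by apply: contra_neq D1 => /(congr1 val).
  have [t _ tx] := D0C x.
  have [|y yE] := exD0 (inv (val x)).
    by exists (GenTree.Node 2 [:: t]) => //=; rewrite -tx.
  exists y; apply: val_inj; rewrite /= yE; apply: invP.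
  by apply: contra_neq x0 => x0; apply: val_inj.
- have /choice[g gE] : forall t, exists x : D0, val x = ev t.
    by move=> t; apply: exD0; exists t.
  apply: (@countable_range _ _ g) => x _; have [t _ tx] := D0C x.
  by exists t => //; apply: val_inj; rewrite gE.
have /choice[r rE] : forall x : R * 'I_n * 'I_n, exists y : D0, val y = rho x.1.1 x.1.2 x.2.
  by move=> [[a i] j] /=; apply: exD0; have [k <-] := eE a i j; exists (GenTree.Leaf k).
pose rho0 a : 'M[D0]_n := \matrix_(i, j) r (a, i, j).
have rho0E a i j : val (rho0 a i j) = rho a i j by rewrite mxE rE.
constructor; apply: (@MatrixRep R D0 n rho0) => [a b|a b|];
  apply/matrixP => i j; apply: val_inj.
- by rewrite rho0E rep_add [in RHS]mxE [in LHS]mxE [RHS]raddfD /= !rho0E.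
- rewrite rho0E rep_mul [in RHS]mxE [in LHS]mxE [RHS]raddf_sum.
  by apply: eq_bigr => k _; rewrite [RHS]rmorphM /= !rho0E.
- by rewrite rho0E rep_one !mxE; case: (i == j).
Qed.

(** * Topologies defined by a filtration *)

(** The filtration is recorded in the type so that the topology can be inferred
    from it. *)
Definition linear_topology (R : pzRingType) (M : lmodType R) (F : nat -> set M)
  (sF : forall k, submodule (F k)) (dF : forall k, F k.+1 `<=` F k) : Type := M.

Section LinearTopology.
Context (R : pzRingType) (M : lmodType R) (F : nat -> set M).
Context (sF : forall k, submodule (F k)) (dF : forall k, F k.+1 `<=` F k).

Local Notation L := (linear_topology sF dF).

HB.instance Definition _ := GRing.Zmodule.copy L M.

Lemma filtration_le k m : (k <= m)%N -> F m `<=` F k.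
Proof.
move=> km; rewrite -(subnKC km); elim: (m - k)%N => [|n IH]; first by rewrite addn0.
by rewrite addnS; apply: subset_trans IH; exact: dF.
Qed.

Definition linear_nbhs (x : L) : set_system L :=
  [set B | exists k, forall y : L, F k (y - x) -> B y].

HB.instance Definition _ := hasNbhs.Build L linear_nbhs.

Lemma linear_nbhs_filter (x : L) : ProperFilter (nbhs x).
Proof.
split.
  by move=> [k kP]; apply: (kP x); rewrite subrr; exact: submodule0.
split.
- by exists 0%N.
- move=> B C [k kP] [m mP]; exists (maxn k m) => y Fy; split.
    by apply/kP/filtration_le/Fy; rewrite leq_maxl.
  by apply/mP/filtration_le/Fy; rewrite leq_maxr.
- by move=> B C BC [k kP]; exists k => y /kP /BC.
Qed.

Lemma linear_nbhs_singleton (x : L) (B : set L) : nbhs x B -> B x.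
Proof. by move=> [k]; apply; rewrite subrr; exact: submodule0. Qed.

Lemma linear_nbhs_nbhs (x : L) (B : set L) : nbhs x B -> nbhs x (nbhs^~ B).
Proof.
move=> [k kP]; exists k => y Fy; exists k => z Fz; apply: kP.
by rewrite -(subrKA y); exact: submoduleD.
Qed.

HB.instance Definition _ := Nbhs_isNbhsTopological.Build L
  linear_nbhs_filter linear_nbhs_singleton linear_nbhs_nbhs.

Lemma linear_sub_continuous : continuous (fun x : L * L => x.1 - x.2).
Proof.
move=> [x y] B [k kP].
exists ([set u | F k (u - x)], [set v | F k (v - y)]) => /=; first by split; exists k.
move=> [u v] /= [Fu Fv]; apply: kP.
have -> : u - v - (x - y) = (u - x) - (v - y).
  by rewrite !opprB addrACA [RHS]addrACA [- v - x]addrC.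
exact: submoduleB.
Qed.

HB.instance Definition _ := PreTopologicalNmodule_isTopologicalZmodule.Build L
  linear_sub_continuous.

Let scale (a : R) (x : L) : L := a *: (x : M).
Lemma linear_scaleA a b v : scale a (scale b v) = scale (a * b) v.
Proof. exact: scalerA. Qed.
Lemma linear_scale1 : left_id 1 scale.
Proof. exact: scale1r. Qed.
Lemma linear_scaleDr : right_distributive scale +%R.
Proof. exact: scalerDr. Qed.
Lemma linear_scaleDl v : {morph scale^~ v : a b / a + b}.
Proof. by move=> a b; exact: scalerDl. Qed.

Lemma linear_scale_continuous :
  continuous (fun z : discrete_topology R * L => scale z.1 z.2).
Proof.
move=> [a x] B [k kP].
exists ([set a : discrete_topology R], [set y | F k (y - x)]) => /=.
  by split; [|exists k].
move=> [b y] /= [-> Fy]; apply: kP.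
by rewrite -scalerBr; exact: submoduleZ.
Qed.

Definition linear_module : topModule R :=
  @TopModule R L scale linear_scaleA linear_scale1 linear_scaleDr linear_scaleDl
    linear_scale_continuous.

End LinearTopology.

Section LinearPolish.
Context (K : realType) (R : pzRingType) (M : lmodType R) (F : nat -> set M).
Context (sF : forall k, submodule (F k)) (dF : forall k, F k.+1 `<=` F k).
Hypothesis Fsep : forall z, (forall k, F k z) -> z = 0.
Hypothesis Fcomplete : forall u : nat -> M,
  (forall k, exists N, forall m n, (N <= m)%N -> (N <= n)%N -> F k (u m - u n)) ->
  exists l, forall k, exists N, forall n, (N <= n)%N -> F k (u n - l).
Hypothesis Fcountable : exists2 D : set M, countable D &
  forall x k, exists2 y, D y & F k (y - x).

Local Notation h := (2^-1 : K).

(** The ultrametric norm of the filtration: [2^-k] for the least [k] such that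
    [F k] does not contain the point. *)
Lemma linear_norm : exists nu : M -> K,
  [/\ forall z, 0 <= nu z, forall z, nu z = 0 <-> z = 0,
      forall z k, nu z < h ^+ k <-> F k z & forall z, z != 0 -> exists k, nu z = h ^+ k].
Proof.
have h0 k : 0 < h ^+ k by rewrite exprn_gt0 // invr_gt0.
suff /choice[nu nuP] : forall z, exists r : K, [/\ 0 <= r, r = 0 <-> z = 0,
    forall k, r < h ^+ k <-> F k z & z != 0 -> exists k, r = h ^+ k].
  by exists nu; split=> [z|z|z k|z]; have [] := nuP z.
move=> z; have [->|z0] := eqVneq z 0.
  by exists 0; split=> // k; split=> // _; exact: submodule0.
pose P k := `[< ~ F k z >].
have exP : exists k, P k.
  apply: contrapT => /forallNP nP; move/eqP: z0; apply; apply: Fsep => k.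
  by apply: contrapT => nF; apply: (nP k); apply/asboolP.
case: (ex_minnP exP) => v /asboolP nFv minv.
exists (h ^+ v); split; first exact: ltW.
- by split=> [hv|]; [have := h0 v; rewrite hv ltxx|move/eqP: z0].
- move=> k; rewrite ltr_iXn2l ?invr_gt0 // ?invf_lt1 ?ltr1n //; split=> [kv|Fk].
    by apply: contrapT => nF; have := minv k (asboolT nF); rewrite leqNgt kv.
  by rewrite ltnNge; apply/negP => vk; apply: nFv; exact: (filtration_le dF vk).
- by exists v.
Qed.

Lemma linear_polish : polish K (linear_module sF dF).
Proof.
have [nu [nu0 nuE nuF nuX]] := linear_norm.
have nuN z : nu (- z) = nu z.
  suff H y : nu (- y) <= nu y by apply/eqP; rewrite eq_le H -{1}[z]opprK H.
  rewrite leNgt; apply/negP => ynu.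
  have ny0 : - y != 0 by apply/eqP => /nuE y0; move: ynu; rewrite y0 ltNge nu0.
  have [k kE] := nuX _ ny0; move: (ynu); rewrite {1}kE => /nuF Fy.
  by have /nuF := submoduleN (sF k) Fy; rewrite kE ltxx.
have nuD x y : nu (x + y) <= nu x + nu y.
  rewrite leNgt; apply/negP => ynu.
  have ny0 : x + y != 0.
    by apply/eqP => /nuE y0; move: ynu; rewrite y0 ltNge addr_ge0.
  have [k kE] := nuX _ ny0; move: (ynu); rewrite kE => ltk.
  have Fx : F k x by apply/nuF; apply: le_lt_trans ltk; rewrite lerDl.
  have Fy : F k y by apply/nuF; apply: le_lt_trans ltk; rewrite lerDr.
  by have /nuF := submoduleD (sF k) Fx Fy; rewrite kE ltxx.
have small (e : K) : 0 < e -> exists k, h ^+ k < e.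
  move=> e0; exists (Num.bound e^-1); have := upper_nthrootP (leqnn (Num.bound e^-1)).
  by rewrite exprVn => H; rewrite invf_plt // posrE exprn_gt0.
have [D cD DP] := Fcountable.
split.
  exists (D : set (linear_module sF dF)) => //.
  move=> O [x Ox] oO; have : nbhs x O by exact: open_nbhs_nbhs.
  by move=> [k kP]; have [y Dy Fy] := DP x k; exists y; split=> //; exact: kP.
exists (fun x y => nu (x - y)); split.
- split=> //.
  + by move=> x y; split=> [/nuE/eqP|->]; [rewrite subr_eq0 => /eqP|apply/nuE; rewrite subrr].
  + by move=> x y; rewrite -nuN opprB.
  + by move=> x y z; rewrite -[x - z](subrKA y); exact: nuD.
- move=> x B; split.
    move=> [k kP]; exists (h ^+ k); first by rewrite exprn_gt0 // invr_gt0.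
    by move=> y /= yk; apply: kP; apply/nuF; rewrite -nuN opprB.
  move=> [e e0 eB]; have [k ke] := small e e0; exists k => y Fy; apply: eB => /=.
  apply: lt_trans ke; rewrite -nuN opprB; exact/nuF.
- move=> u uC; have [k|l lP] := Fcomplete (u := u).
    have [|N NP] := uC (h ^+ k); first by rewrite exprn_gt0 // invr_gt0.
    by exists N => m n Nm Nn; apply/nuF; exact: NP.
  exists l => B [k kP]; have [N NP] := lP k; exists N => // n /= Nn; apply: kP.
  exact: NP.
Qed.

End LinearPolish.

(** * Polish column modules *)

Section ColumnPolish.
Context (K : realType) (R D : pzRingType) (n : nat) (rho : matrix_rep R D n).
Hypothesis n0 : (0 < n)%N.
Hypothesis dD : division_ring D.
Hypothesis cD : countable [set: D].

Let N : lmodType D := nat -> D^o.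
Let M : lmodType R := column_module rho N.

(** Vectors of sequences that vanish before [k]: they define the product topology. *)
Definition tail_submodule (k : nat) : set M :=
  [set x | forall j i, (i < k)%N -> (x j : nat -> D) i = 0].

Lemma tail_submodule_sub k : submodule (tail_submodule k).
Proof.
apply/submoduleP; split=> //.
  by move=> x y Fx Fy j i ik; rewrite -[LHS]/((x j : nat -> D) i + (y j : nat -> D) i) Fx // Fy // addr0.
move=> a x Fx j i ik; rewrite column_scaleE fct_sumE big1 // => l _.
by rewrite -[LHS]/(rho a j l * (x l : nat -> D) i) Fx // mulr0.
Qed.

Lemma tail_submodule_dec k : tail_submodule k.+1 `<=` tail_submodule k.
Proof. by move=> x Fx j i ik; apply: Fx; exact: ltnW. Qed.

Definition column_topmodule : topModule R := linear_module tail_submodule_sub tail_submodule_dec.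

Lemma tailB k (x y : M) : tail_submodule k (x - y) <->
  forall j i, (i < k)%N -> (x j : nat -> D) i = (y j : nat -> D) i.
Proof.
split=> H j i ik; last first.
  by rewrite -[LHS]/((x j : nat -> D) i - (y j : nat -> D) i) H // subrr.
by apply/eqP; rewrite -subr_eq0; apply/eqP; exact: (H j i ik).
Qed.

Lemma column_polish : polish K column_topmodule.
Proof.
apply: linear_polish.
- move=> z zF; apply/funext => j; apply/funext => i; exact: (zF i.+1).
- move=> u uC; have /choice[c cP] k : exists c, forall m l, (c <= m)%N -> (c <= l)%N ->
      tail_submodule k (u m - u l) := uC k.
  pose l : M := fun j i => (u (c i.+1) j : nat -> D) i.
  exists l => k; exists (\max_(i < k) c i.+1) => m cm; apply/tailB => j i ik.
  have cim : (c i.+1 <= m)%N.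
    apply: leq_trans cm.
    exact: (leq_bigmax (F := fun i : 'I_k => c i.+1) (Ordinal ik)).
  by have /tailB H := cP i.+1 m (c i.+1) cim (leqnn _); exact: H.
- have [e eD] := countable_enum (0 : D) cD.
  have /choice[c cE] x : exists k, e k = x by have [k _ kx] := eD x Logic.I; exists k.
  pose g (f : {ffun 'I_n -> seq nat}) : M := fun j i =>
    if (i < size (f j))%N then e (nth 0%N (f j) i) else 0.
  exists (range g); first exact: (@countable_range _ _ g).
  move=> x k; exists (g [ffun j => [seq c ((x j : nat -> D) i) | i <- iota 0 k]]); first by eexists.
  apply/tailB => j i ik; rewrite /g ffunE size_map size_iota ik.
  by rewrite (nth_map 0%N) ?size_iota // nth_iota.
Qed.

(** This is Cantor's diagonal argument. *)
Lemma column_uncountable : ~ countable [set: column_topmodule].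
Proof.
move=> /(countable_enum (0 : M))[e eP].
(* Its [k]-th entry differs from that of [e k]. *)
pose x : M := fun j i => if (e i j : nat -> D) i == 0 then 1 else 0.
have [k _ ek] := eP x Logic.I; have [D1 _] := dD.
have := congr1 (fun z : M => (z (Ordinal n0) : nat -> D) k) ek.
rewrite /x /=; case: eqP => [ek0 ek1|//]; move/eqP: D1; apply.
by rewrite -ek1 ek0.
Qed.

(** A basis of [D^nat] over [D] decomposes [(D^nat)^n] into the countable
    submodules [(D b)^n]. *)
Lemma column_kaplansky : exists (I : choiceType) (U : I -> set column_topmodule),
  kaplansky_decomposition U.
Proof.
have [|B [_ iB spB]] := @basis_exists D dD N set0.
  by move=> s c _ s0 _ b /s0.
have [p prj] := basis_projections iB spB.
pose U (b : {b : N | b \in B}) : set N := [set x | exists d : D, x = d *: val b].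
pose W b : set M := [set x | forall j, U b (x j)].
have sW b : submodule (W b).
  apply/submoduleP; split.
  - by move=> j; exists 0; rewrite scale0r.
  - move=> x y Wx Wy j; have [[a xE] [c yE]] := (Wx j, Wy j).
    by exists (a + c); rewrite scalerDl -xE -yE.
  - move=> a x /choice[c cE] j; exists (\sum_l rho a j l * c l).
    rewrite column_scaleE scaler_suml; apply: eq_bigr => l _.
    by rewrite cE scalerA.
exists {b : N | b \in B}, W; split; last first.
  exact: (projections_direct_sum sW (column_projections rho prj)).
move=> b; split; first exact: sW.
- apply/eqP => W0; have : W b (fun=> val b) by move=> j; exists 1; rewrite scale1r.
  rewrite W0 => /(congr1 (fun z : M => z (Ordinal n0))) b0.
  have Bb : B (val b) by have := valP b; rewrite inE.
  have [D1 _] := dD; move/eqP: D1; apply.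
  apply: (iB [:: val b] (fun=> 1)) => //; last by rewrite inE.
    by move=> b'; rewrite inE => /eqP ->.
  by rewrite big_seq1 scale1r.
- have [e eD] := countable_enum (0 : D) cD.
  have /choice[c cE] x : exists k, e k = x by have [k _ kx] := eD x Logic.I; exists k.
  apply: (@countable_range _ _ (fun (f : {ffun 'I_n -> nat}) => (fun j => e (f j) *: val b) : M)).
  move=> x /choice[d dE]; exists [ffun j => c (d j)] => //.
  by apply/funext => j; rewrite ffunE cE dE.
Qed.

End ColumnPolish.

Lemma represented_polish (K : realType) (R : pzRingType) m :
  countable [set: R] -> (0 < m)%N -> represented R m ->
  exists A : topModule R, [/\ polish K A, ~ countable [set: A]
     & exists (I : choiceType) (U : I -> set A), kaplansky_decomposition U].
Proof.
move=> cR m0 [D [dD [rho]]].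
have [D0 [dD0 cD0 [rho0]]] := countable_division_subring rho cR dD.
exists (column_topmodule rho0); split.
- exact: column_polish.
- exact: column_uncountable.
- exact: column_kaplansky.
Qed.

(* Left R-modules are [lmodType R]; right R-modules are left modules over the
   opposite ring, [lmodType R^c]. *)
Theorem theorem1p6 (K : realType) (R : nzRingType)
    (R_countable : countable [set: R]) :
  ((exists A : topModule R,
      [/\ polish K A, ~ countable [set: A]
        & exists (I : choiceType) (U : I -> set A),
            kaplansky_decomposition U])
   <-> (exists V : lmodType R, indecomposable V /\ endofinite V))
  /\
  ((exists A : topModule R,
      [/\ polish K A, ~ countable [set: A]
        & exists (I : choiceType) (U : I -> set A),
            kaplansky_decomposition U])
   <-> (exists V : lmodType R^c, indecomposable V /\ endofinite V)).
Proof.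
have toE : (exists A : topModule R, [/\ polish K A, ~ countable [set: A]
    & exists (I : choiceType) (U : I -> set A), kaplansky_decomposition U]) ->
    exists2 m, (0 < m)%N & represented R m.
  move=> [A [pA uA [I [U kU]]]].
  exact: (proj1 (endofinite_structure (polish_kaplansky_endofinite pA uA kU))).
have fromE m : (0 < m)%N -> represented R m -> exists A : topModule R,
    [/\ polish K A, ~ countable [set: A]
    & exists (I : choiceType) (U : I -> set A), kaplansky_decomposition U].
  exact: represented_polish.
split; split.
- move=> /toE[m m0 /(represented_endofinite m0)/endofinite_structure[_ //]].
- move=> [V [iV eV]].
  have [[m m0 rm] _] := endofinite_structure (indecomposable_endofinite iV eV).
  exact: fromE rm.
- move=> /toE[m m0 /represented_conv/(represented_endofinite m0)/endofinite_structure[_ //]].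
- move=> [V [iV eV]].
  have [[m m0 /represented_conv2 rm] _] :=
    endofinite_structure (indecomposable_endofinite iV eV).
  exact: fromE rm.
Qed.
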